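(* Let $q$ be an odd prime power and $C\subseteq\mathbb F_q$. Suppose one of the following holds: (1) $C=D_i^4\cup D_{i+1}^4$, $q\equiv 5\pmod 8$ and $q=s^2+4$ with $s\equiv 1\pmod 4$; (2) $C=D_0^8\cup D_1^8\cup D_2^8\cup D_5^8$ and $q=l^2$ where $l$ is a prime power with $l=t^2+2\equiv 3\pmod 8$; (3) $q=l^2$ for some prime power $l$ and $C=\bigcup_{i\in I}D_i^{\sqrt q+1}$ where $I\subseteq\{0,1,\dots,\sqrt q\}$ has $|I|=\frac{\sqrt q+1}{2}$ and contains both even and odd numbers. Then $(\mathbb F_q,\operatorname{Dev}D_0^2\cup\operatorname{Dev}D_1^2\cup\operatorname{Dev}C)$ is a $2$-$(q,\frac{q-1}{2},\frac{3q-11}{4})$ adesign.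
   Context: For a primitive element $\alpha$ of $\mathbb F_q$ and a divisor $e$ of $q-1$, the cyclotomic classes of order $e$ are $D_0^e=\langle\alpha^e\rangle$ and $D_i^e=\alpha^iD_0^e$ for $i=1,\dots,e-1$ (indices mod $e$). $\operatorname{Dev}C=\{C+g\mid g\in\mathbb F_q\}$; unions of developments are collections of blocks. A $t$-$(v,k,\lambda)$ adesign is an incidence structure with $v$ points and blocks of size $k$ such that every $t$-subset of points lies in exactly $\lambda$ or exactly $\lambda+1$ blocks, both values occurring. *)

(* Defs.v *)
From HB Require Import structures.
From mathcomp Require Import all_boot all_order all_fingroup all_algebra all_solvable.

Set Implicit Arguments.
Unset Strict Implicit.
Unset Printing Implicit Defensive.

Import GRing.Theory.
Local Open Scope ring_scope.

Definition prime_power (q : nat) : Prop :=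
  exists p n : nat, [/\ prime p, (0 < n)%N & q = (p ^ n)%N].

Section Cyclotomy.

Variable F : finFieldType.

Definition primitive_element (a : {unit F}) : bool :=
  generator [set: {unit F}] a.

(* The class D_i^e = a^i <a^e>.  When e divides #|F| - 1 it depends on i only
   modulo e, so that indices modulo e are just natural numbers here. *)
Definition cyclotomic_class (a : {unit F}) (e i : nat) : {set F} :=
  [set val a ^+ i * val u | u in <[a ^+ e]>%g].

Definition translate (C : {set F}) (g : F) : {set F} := [set x + g | x in C].

(* Collections of blocks are multisets, represented by sequences up to
   permutation: the development is indexed by g, and unions of developments
   are concatenations. *)
Definition Dev (C : {set F}) : seq {set F} := [seq translate C g | g : F].

End Cyclotomy.

Section Adesign.

Variable P : finType.

Definition block_degree (B : seq {set P}) (S : {set P}) : nat :=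
  count (fun b : {set P} => S \subset b) B.

Definition is_adesign (t v k lambda : nat) (B : seq {set P}) : Prop :=
  [/\ #|P| = v,
      forall b : {set P}, b \in B -> #|b| = k,
      forall S : {set P}, #|S| = t ->
        block_degree B S = lambda \/ block_degree B S = lambda.+1,
      exists2 S : {set P}, #|S| = t & block_degree B S = lambda
    & exists2 S : {set P}, #|S| = t & block_degree B S = lambda.+1].

End Adesign.

(* Main.v *)
Require Import Defs.
From HB Require Import structures.
From mathcomp Require Import all_boot all_order all_fingroup all_algebra all_solvable.
From mathcomp Require Import all_field zify ring.

(* Write Delta_C(d) for the number of z in C with z + d in C; it is the number of translates of C
   containing a given pair with difference d.  Squares and nonsquares together contribute
   (q - 3) / 2 for every d, so it suffices to show that Delta_C(d) is (q - 5) / 4 or (q - 1) / 4;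
   both values then occur because the Delta_C(d) sum to |C| (|C| - 1).  With g = 1 on C and
   g = -1 on the other nonzero elements, Delta_C is read off the autocorrelation of g.
   (1) The autocorrelation of g is +- b - 1, where a + b i is a quartic Jacobi sum, of norm
   a^2 + b^2 = q.  Modulo p it reduces, up to sign and conjugation, to a binomial coefficient
   prime to p, so p does not divide a and q = s^2 + 4 forces b = +- 2.
   (3) C is a union of lines of F_q minus the origin, F_q being a plane over F_l, and a vector off
   two distinct lines decomposes uniquely along them.
   (2) The even part of g is constant on lines, as in (3).  The odd part changes sign under
   the nonsquares of F_l, and its autocorrelation at d is T^2 - (l + 1) / 2, where T is its sum
   over an affine line parallel to F_l d.  Up to sign T depends only on the class of d modulo fourth
   powers and, by Frobenius symmetry, takes the values X, 2 Y, X, 0 there; summing over d gives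
   X^2 + 2 Y^2 = l.  Again p does not divide X, so l = t^2 + 2 forces Y = +- 1. *)

Set Implicit Arguments.
Unset Strict Implicit.
Unset Printing Implicit Defensive.

(** * Binomial coefficients modulo p and representations of prime powers *)

Section NumberTheory.
Import Order.TTheory GRing.Theory Num.Theory.

(** Legendre's formula over a padded range: the terms with [k > n] vanish, and a common bound lets
    several factorials be compared term by term. *)
Lemma logn_fact_leq (p n N : nat) :
  prime p -> n <= N -> logn p n`! = \sum_(1 <= k < N.+1) n %/ p ^ k.
Proof.
move=> pp leN; rewrite logn_fact // [RHS](big_cat_nat (n := n.+1)) //=.
rewrite [X in _ + X]big_nat_cond [X in _ + X]big1 ?addn0 // => k /andP[/andP[ltk _] _].
by rewrite divn_small // (leq_trans ltk) // ltnW // ltn_expl // prime_gt1.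
Qed.

(* Kummer: no carry occurs when j and i are added in base p. *)
Lemma prime_ndvd_bin (p i j : nat) : prime p ->
  (forall k, j %% p ^ k + i %% p ^ k < p ^ k) -> ~~ (p %| 'C(j + i, j)).
Proof.
move=> pp nocarry.
have := bin_fact (leq_addr i j); rewrite addKn => /(congr1 (logn p)).
have b0 : 0 < 'C(j + i, j) by rewrite bin_gt0 leq_addr.
rewrite !lognM ?muln_gt0 ?fact_gt0 //.
rewrite (logn_fact_leq pp (leq_addr i j)) (logn_fact_leq pp (leq_addl j i)).
rewrite logn_fact // -big_split /=.
under [in X in _ = X -> _]eq_bigr => k _ do
  rewrite divnD ?expn_gt0 ?prime_gt0 // leqNgt nocarry addn0.
move=> /eqP; rewrite -[X in _ == X]add0n eqn_add2r => /eqP l0.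
apply/negP => pd; have := dvdn_leq b0 pd.
by move: pd; rewrite -[p in p %| _]expn1 pfactor_dvdn // l0.
Qed.

Local Open Scope ring_scope.

(* If w = X * m + Y * s (or X * m - Y * s) is divisible by Q = X^2 + k Y^2 = s^2 + k m^2,
   then k w^2 <= Q^2 leaves only w = 0, or w = +-Q with k = 1. *)
Lemma norm_form_unique (p n : nat) (k X Y s m : int) : prime p -> 0 < k ->
  X ^+ 2 + k * Y ^+ 2 = (p ^ n)%:Z -> s ^+ 2 + k * m ^+ 2 = (p ^ n)%:Z ->
  ~~ (p %| 2 * X * m)%Z ->
  Y ^+ 2 = m ^+ 2 \/ (k = 1 /\ X ^+ 2 = m ^+ 2).
Proof.
move=> pp k0; set Q := (p ^ n)%:Z => eX es npX.
have Q0 : 0 < Q by rewrite ltz_nat expn_gt0 prime_gt0.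
have key (e : int) : e ^+ 2 = 1 -> (Q %| X * m + e * Y * s)%Z ->
    Y ^+ 2 = m ^+ 2 \/ (k = 1 /\ X ^+ 2 = m ^+ 2).
  move=> e1 /dvdzP[c hc].
  (* Brahmagupta's identity for [Q * Q]; it bounds the cofactor by [k * c ^+ 2 <= 1]. *)
  have H : (X * s - e * k * Y * m) ^+ 2 + k * (X * m + e * Y * s) ^+ 2 = Q ^+ 2.
    have -> : Q ^+ 2 = (X ^+ 2 + k * (e ^+ 2 * Y ^+ 2)) * (s ^+ 2 + k * m ^+ 2).
      by rewrite e1 mul1r eX es expr2.
    ring.
  have cc : k * c ^+ 2 <= 1.
    rewrite -(ler_pM2r (exprn_gt0 2 Q0)) mul1r -mulrA -exprMn -hc -H.
    by rewrite lerDr sqr_ge0.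
  have [c0|cn0] := eqVneq c 0.
    left; move: hc; rewrite c0 mul0r => /eqP; rewrite addr_eq0 => /eqP h.
    have : (X * m) ^+ 2 = (Y * s) ^+ 2.
      by rewrite h sqrrN -mulrA exprMn e1 mul1r.
    rewrite !exprMn => h2; apply: (mulfI (lt0r_neq0 Q0)).
  have -> : Q * Y ^+ 2 = Y ^+ 2 * s ^+ 2 + k * Y ^+ 2 * m ^+ 2 by rewrite -es; ring.
    by rewrite -h2 -eX; ring.
  right; have c1 : 1 <= c ^+ 2.
    by rewrite -gtz0_ge1 exprn_even_gt0.
  have k1 : k = 1.
    apply/eqP; rewrite eq_le -gtz0_ge1 k0 andbT (le_trans _ cc) //.
    by rewrite ler_peMr // ltW.
  have c2 : c ^+ 2 = 1 by apply/eqP; rewrite eq_le c1 andbT; move: cc; rewrite k1 mul1r.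
  split=> //.
  move: H; rewrite hc exprMn c2 k1 !mul1r -[X in _ = X]add0r => /addIr /eqP.
  rewrite sqrf_eq0 mulr1 subr_eq0 => /eqP h.
  have : (X * s) ^+ 2 = (Y * m) ^+ 2 by rewrite h -mulrA exprMn e1 mul1r.
  rewrite !exprMn => h2; apply: (mulfI (lt0r_neq0 Q0)).
  have -> : Q * X ^+ 2 = X ^+ 2 * s ^+ 2 + X ^+ 2 * m ^+ 2 by rewrite -es k1; ring.
  by rewrite h2 -eX k1; ring.
(* The product of the two candidates is [Q * (m ^+ 2 - Y ^+ 2)] and their sum is [2 * X * m]. So [p]
   fails to divide one of them, and [Q], a power of [p], divides the other. *)
have prod : (Q %| (X * m + 1 * Y * s) * (X * m + (-1) * Y * s))%Z.
  apply/dvdzP; exists (m ^+ 2 - Y ^+ 2).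
  by rewrite [RHS]mulrBl -{1}eX -es; ring.
have npp (u : int) : ~~ (p %| u)%Z -> coprimez Q u.
  by move=> pu; rewrite coprimezE coprimeXl // prime_coprime.
have [p1|p1] := boolP (p %| X * m + 1 * Y * s)%Z; last first.
  by apply: (key (-1)); rewrite ?sqrrN ?expr1n // -(Gauss_dvdzr _ (npp _ p1)).
have [p2|p2] := boolP (p %| X * m + (-1) * Y * s)%Z; last first.
  by apply: (key 1); rewrite ?expr1n // -(Gauss_dvdzl _ (npp _ p2)).
case/negP: npX; have -> : 2 * X * m = (X * m + 1 * Y * s) + (X * m + (-1) * Y * s) by ring.
by rewrite rpredD.
Qed.

End NumberTheory.

(** * Difference functions and correlations *)

Section Correlation.
Import Order.TTheory GRing.Theory Num.Theory.
Local Open Scope ring_scope.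
Variable F : finFieldType.

Definition delta (C : {set F}) (d : F) : nat := #|[set z in C | z + d \in C]|.

Definition acorr (R : pzRingType) (f : F -> R) (d : F) : R := \sum_z f z * f (z + d).

Lemma sum_acorr (R : pzRingType) (f : F -> R) :
  \sum_d acorr f d = (\sum_z f z) * (\sum_z f z).
Proof.
rewrite exchange_big /= mulr_suml; apply: eq_bigr => z _.
by rewrite -mulr_sumr; congr (_ * _); rewrite [RHS](reindex_inj (addrI z)).
Qed.

Lemma acorr0 (R : pzRingType) (f : F -> R) : acorr f 0 = \sum_z f z * f z.
Proof. by apply: eq_bigr => z _; rewrite addr0. Qed.

Lemma deltaE (R : pzRingType) (C : {set F}) (d : F) :
  (delta C d)%:R = acorr (fun z => (z \in C)%:R : R) d.
Proof.
rewrite /delta -sum1_card natr_sum big_mkcond; apply: eq_bigr => z _.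
by rewrite inE -natrM mulnb; case: (_ && _).
Qed.

Lemma sum_mem (R : pzRingType) (C : {set F}) : \sum_z (z \in C)%:R = #|C|%:R :> R.
Proof. by rewrite -sum1_card natr_sum [RHS]big_mkcond; apply: eq_bigr => z _; case: (_ \in _). Qed.

Lemma sum_delta (C : {set F}) : (\sum_d delta C d = #|C| * #|C|)%N.
Proof.
apply/eqP; rewrite -(eqr_nat int) natr_sum natrM -sum_mem -sum_acorr.
by apply/eqP/eq_bigr => d _; rewrite deltaE.
Qed.

Lemma delta0 (C : {set F}) : delta C 0 = #|C|.
Proof. by apply: eq_card => z; rewrite inE addr0 andbb. Qed.

(** Multiplication by [b] is an additive automorphism; this reduces case (1) to [i = 0]. *)
Lemma delta_scale (b : F) (C : {set F}) (d : F) : b != 0 ->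
  delta [set b * x | x in C] (b * d) = delta C d.
Proof.
move=> b0; rewrite /delta.
rewrite -[RHS](card_imset _ (mulfI b0)); apply: eq_card => z.
have bI := mulfI b0.
rewrite -[z](mulVKf b0) (mem_imset _ _ bI) !inE -mulrDr.
by rewrite !(mem_imset _ _ bI).
Qed.

(** The translate by [g] contains [x] and [y] exactly when [z = x - g] and [z + (y - x)] lie in [C],
    and [g |-> x - g] is a bijection. *)
Lemma block_degree_Dev (C : {set F}) (x y : F) :
  block_degree (Dev C) [set x; y] = delta C (y - x).
Proof.
have tI g z : (z \in translate C g) = (z - g \in C).
  by rewrite -{1}(subrK g z) (mem_imset _ _ (addIr g)).
rewrite /block_degree /Dev /image_mem count_map -sum1_count big_enum_cond /=.
rewrite sum1dep_card /delta -[RHS](card_imset _ (subrI x)).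
apply: eq_card => g; rewrite -[g in RHS](subKr x) (mem_imset _ _ (subrI x)).
rewrite !inE subUset !sub1set !tI.
by have -> : x - g + (y - x) = y - g by ring.
Qed.

Lemma card_translate (C : {set F}) (g : F) : #|translate C g| = #|C|.
Proof. by rewrite card_imset //; apply: addIr. Qed.

Lemma adesign_of_delta (q : nat) (D0 D1 C : {set F}) : #|F| = q -> odd q ->
  #|D0| = ((q - 1) %/ 2)%N -> #|D1| = ((q - 1) %/ 2)%N -> #|C| = ((q - 1) %/ 2)%N ->
  (forall d, d != 0 -> (2 * (delta D0 d + delta D1 d) + 3 = q)%N) ->
  (forall d, d != 0 -> (4 * delta C d + 5 = q \/ 4 * delta C d + 1 = q)%N) ->
  is_adesign 2 q ((q - 1) %/ 2) ((3 * q - 11) %/ 4) (Dev D0 ++ Dev D1 ++ Dev C).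
Proof.
move=> cF oq c0 c1 cC h01 hC.
have q1 : (1 < q)%N by rewrite -cF finNzRing_gt1.
have q5 : (5 <= q)%N by case: (hC 1 (oner_neq0 _)); move: oq q1; lia.
have bd x y : block_degree (Dev D0 ++ Dev D1 ++ Dev C) [set x; y] =
    (delta D0 (y - x)%R + delta D1 (y - x)%R + delta C (y - x)%R)%N.
  by rewrite -!block_degree_Dev /block_degree !count_cat addnA.
have bd_val x y : x != y ->
    (4 * delta C (y - x)%R + 5 = q -> block_degree (Dev D0 ++ Dev D1 ++ Dev C) [set x; y]
      = (3 * q - 11) %/ 4)%N /\
    (4 * delta C (y - x)%R + 1 = q -> block_degree (Dev D0 ++ Dev D1 ++ Dev C) [set x; y]
      = ((3 * q - 11) %/ 4).+1)%N.
  move=> xy; have d0 : y - x != 0 by rewrite subr_eq0 eq_sym.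
  rewrite bd; move: (h01 _ d0) q5.
  move: (delta D0 _ + delta D1 _)%N (delta C _) => u v; clear; lia.
have total : ((\sum_(d : F | d != 0%R) 4 * delta C d) + 4 * #|C| = 4 * (#|C| * #|C|))%N.
  by rewrite -sum_delta [in RHS](bigD1 0) //= delta0 mulnDr big_distrr addnC.
have cnz : #|[pred d : F | d != 0]| = q.-1.
  by rewrite -cF -(cardC1 (0 : F)); apply: eq_card => d; rewrite !inE.
(* The mean of [delta C d] over nonzero [d] is [(q - 3) / 4], midway between the two allowed values,
   so [delta C] cannot be constantly either of them. *)
have ex2 (c : nat) : (c = 1 \/ c = 5)%N ->
    (forall d, d != 0 -> (4 * delta C d + c = q)%N) -> False.
  move=> cE hall; have : (\sum_(d : F | d != 0%R) (4 * delta C d + c) = q.-1 * q)%N.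
    by rewrite (eq_bigr (fun=> q)) // sum_nat_const cnz.
  rewrite big_split /= sum_nat_const cnz; move: total; rewrite cC.
  have [k [-> -> ->] k0] : exists2 k, [/\ (q - 1) %/ 2 = k, q.-1 = 2 * k
    & q = (2 * k).+1]%N & (0 < k)%N by exists ((q - 1) %/ 2)%N; first split; lia.
  by move: (\sum_(d | _) _)%N => T; case: cE => ->; nia.
have exd (c c' : nat) : (c = 1 \/ c = 5)%N ->
    (forall d, d != 0 -> (4 * delta C d + c = q \/ 4 * delta C d + c' = q)%N) ->
    exists2 d, d != 0 & (4 * delta C d + c' = q)%N.
  move=> cE h; case: (pickP [pred d : F | (d != 0) && (4 * delta C d + c' == q)%N]).
    by move=> d /andP[d0 /eqP ?]; exists d.
  move=> nd; case: (ex2 c cE) => d d0; case: (h d d0) => // /eqP e.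
  by have := nd d; rewrite /= d0 e.
split=> //.
- move=> b; rewrite !mem_cat => /or3P[] /mapP[g _ ->]; rewrite card_translate ?c0 ?c1 ?cC //.
- move=> S /eqP /cards2P[x [y [xy ->]]]; have d0 : y - x != 0 by rewrite subr_eq0 eq_sym.
  have [v1 v2] := bd_val x y xy.
  by case: (hC _ d0) => [/v1|/v2] ->; [left|right].
- case: (exd 1 5)%N => [|d d0|d d0 e]; [by left|by case: (hC d d0); [right|left]|].
  exists [set 0; d]; first by rewrite cards2 eq_sym d0.
  have := bd_val 0 d; rewrite subr0 eq_sym => /(_ d0) [v1 v2].
  by apply: v1.
case: (exd 5 1)%N => [|d d0|d d0 e]; [by right|by case: (hC d d0); [left|right]|].
exists [set 0; d]; first by rewrite cards2 eq_sym d0.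
have := bd_val 0 d; rewrite subr0 eq_sym => /(_ d0) [v1 v2].
by apply: v2.
Qed.

(* For z, z + d in L the quotient z / (z + d) = 1 - d / (z + d) takes every value of L but 1. *)
Lemma sum_ratio (R : zmodType) (L : {pred F}) (f : F -> R) (d : F) :
  divring_closed L -> d \in L -> d != 0 -> f 0 = 0 ->
  \sum_(z in L) f (z / (z + d)) = \sum_(z in L) f z - f 1.
Proof.
move=> [L1 LB LV] dL d0 f0.
have L0 : 0 \in L by rewrite -(subrr 1) LB.
have LN x : (- x \in L) = (x \in L).
  by apply/idP/idP => h; [rewrite -[x]opprK -[- - x]sub0r LB|rewrite -sub0r LB].
have LDd x : (x - d \in L) = (x \in L).
  apply/idP/idP => h; last exact: LB.
  by have := LB _ _ h (etrans (LN d) dL); rewrite opprK subrK.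
have LdV x : (d / x \in L) = (x \in L).
  apply/idP/idP => h; last exact: LV.
  by have [->//|x0] := eqVneq x 0; rewrite -(divKf d0 x) LV.
have L1B x : (1 - x \in L) = (x \in L).
  by apply/idP/idP => h; [rewrite -[x](subKr 1) LB|exact: LB].
rewrite (reindex_inj (addIr (- d))) /= (eq_bigl _ _ LDd).
(* At [x = 0], that is [z = - d], the quotient is 0 by the convention [0^-1 = 0], and [f 0 = 0]
   removes the term. On the right, [x = 0] is the term [f 1]. *)
rewrite (bigD1 0) //= subrK invr0 mulr0 f0 add0r.
rewrite [in RHS](reindex_inj (subrI 1)) /= (eq_bigl _ _ L1B).
have dI : injective (fun x => d / x) by move=> x y /(mulfI d0) /invr_inj.
rewrite [in RHS](reindex_inj dI) /= (eq_bigl _ _ LdV).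
rewrite [in RHS](bigD1 0) //= invr0 mulr0 subr0 addrAC subrr add0r.
apply: eq_bigr => x /andP[_ x0]; rewrite subrK mulrBl divff //.
Qed.

(** The function [g] of the overview, with value 0 at 0 when [0 \notin C]. *)
Definition balance (C : {set F}) (z : F) : int := 2 * (z \in C)%:R - (z != 0)%:R.

Lemma acorr_nz (R : pzRingType) (d : F) : d != 0 ->
  acorr (fun z => (z != 0)%:R : R) d = #|F|%:R - 2.
Proof.
move=> d0; rewrite /acorr.
rewrite (bigD1 0) //= eqxx mul0r add0r (bigD1 (- d)) ?oppr_eq0 //= addNr eqxx mulr0 add0r.
rewrite (eq_bigr (fun=> 1)); last first.
  by move=> z /andP[z0 zd]; rewrite z0 addr_eq0 zd mulr1.
rewrite sumr_const; apply/eqP; rewrite eq_sym subr_eq -natrD.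
apply/eqP; congr (_%:R).
have := cardsC [set 0; - d]; rewrite cards2 eq_sym oppr_eq0 d0 => <-.
rewrite addnC; congr (_ + _)%N; apply: eq_card => z; rewrite !inE negb_or.
by rewrite unfold_in.
Qed.

(** Expand the product of the balance function with its shift. Each cross term is [#|C|], less one
    if [- d], respectively [d], lies in [C], and the size of [C] absorbs the constants. *)
Lemma delta_balance (C : {set F}) (d : F) : 0 \notin C -> ((2 * #|C|).+1 = #|F|)%N -> d != 0 ->
  4 * (delta C d)%:R = acorr (balance C) d + #|F|%:R
    - 2 * (d \in C)%:R - 2 * (- d \in C)%:R :> int.
Proof.
move=> C0 cC d0; rewrite deltaE.
have e1 : \sum_z (z \in C)%:R * (z + d != 0 :> F)%:R = #|C|%:R - (- d \in C)%:R :> int.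
  rewrite -sum_mem (bigD1 (- d)) //= [in RHS](bigD1 (- d)) //= addNr eqxx mulr0 add0r.
  rewrite addrAC subrr add0r; apply: eq_bigr => z zd.
  by rewrite addr_eq0 zd mulr1.
have e2 : \sum_z (z != 0 :> F)%:R * (z + d \in C)%:R = #|C|%:R - (d \in C)%:R :> int.
  rewrite -sum_mem (reindex_inj (addIr (- d))) /= (bigD1 d) //= [in RHS](bigD1 d) //=.
  rewrite subrr eqxx mul0r add0r addrAC subrr add0r; apply: eq_bigr => z zd.
  by rewrite subr_eq0 zd subrK mul1r.
have -> : acorr (balance C) d = 4 * acorr (fun z => (z \in C)%:R) d
    - 2 * (\sum_z (z \in C)%:R * (z + d != 0 :> F)%:R)
    - 2 * (\sum_z (z != 0 :> F)%:R * (z + d \in C)%:R)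
    + acorr (fun z => (z != 0 :> F)%:R) d.
  rewrite /acorr !mulr_sumr -!sumrB -big_split /=; apply: eq_bigr => z _.
  by rewrite /balance; ring.
rewrite e1 e2 acorr_nz // -cC; move: #|C| => k.
rewrite -[in (_.+1)%:R]natr1; ring.
Qed.

End Correlation.

(** * Discrete logarithms *)

Section DiscreteLog.
Import Order.TTheory GRing.Theory Num.Theory.
Local Open Scope ring_scope.

Definition periodic (T : Type) (e : nat) (w : nat -> T) := forall k, w (k %% e)%N = w k.

Lemma periodic_eq (T : Type) (e : nat) (w : nat -> T) i j :
  periodic e w -> i = j %[mod e] -> w i = w j.
Proof. by move=> pw eij; rewrite -pw eij pw. Qed.

(** Reduces an identity between periodic functions to a computation over one period. *)
Lemma periodic_forall (T : eqType) (e : nat) (u v : nat -> T) :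
  (0 < e)%N -> periodic e u -> periodic e v -> all (fun j => u j == v j) (iota 0 e) -> u =1 v.
Proof.
move=> e0 pu pv /allP h k; rewrite -pu -pv; apply/eqP/h.
by rewrite mem_iota ltn_mod.
Qed.

Lemma periodic_comp (T : Type) (e c b : nat) (w : nat -> T) :
  periodic e w -> periodic e (fun k => w (c * k + b)%N).
Proof.
by move=> pw k; apply: (periodic_eq pw); rewrite -modnDml modnMmr modnDml.
Qed.

Lemma sum_periodic (R : nmodType) (e m : nat) (w : nat -> R) : periodic e w ->
  \sum_(k < m * e) w k = (\sum_(i < e) w i) *+ m.
Proof.
move=> pw; elim: m => [|m IH]; first by rewrite big_ord0.
rewrite mulSn addnC big_split_ord /= IH mulrSr; congr (_ + _).
apply: eq_bigr => i _; apply: (periodic_eq pw).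
by rewrite modnMDl.
Qed.

Variables (F : finFieldType) (A : F).
Hypothesis hA : (#|F|.-1).-primitive_root A.

Lemma expf_card1 (x : F) : x != 0 -> x ^+ #|F|.-1 = 1.
Proof.
move=> x0; apply: (mulfI x0); rewrite -exprS prednK ?expf_card ?mulr1 //.
by apply/card_gt0P; exists 0.
Qed.

Lemma prim_root_neq0 : A != 0.
Proof.
apply/eqP => A0; have := prim_expr_order hA; rewrite A0 expr0n.
by rewrite (gtn_eqF (prim_order_gt0 hA)) => /eqP; rewrite eq_sym oner_eq0.
Qed.

(* Junk value: dlog 0 = 0. *)
Definition dlog (x : F) : nat :=
  if [pick k : 'I_(#|F|.-1) | x == A ^+ k] is Some k then k : nat else 0%N.

Lemma dlog_lt (x : F) : (dlog x < #|F|.-1)%N.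
Proof.
rewrite /dlog; case: pickP => [k _|_]; [exact: ltn_ord|exact: prim_order_gt0 hA].
Qed.

Lemma dlogK (x : F) : x != 0 -> A ^+ dlog x = x.
Proof.
move=> x0; rewrite /dlog; case: pickP => [k /eqP -> //|].
by have [k xk] := prim_rootP hA (expf_card1 x0) => /(_ k); rewrite xk eqxx.
Qed.

Lemma dlog_pow (e k : nat) : (e %| #|F|.-1)%N -> dlog (A ^+ k) = k %[mod e].
Proof.
move=> en; have : A ^+ dlog (A ^+ k) = A ^+ k by rewrite dlogK // expf_neq0 // prim_root_neq0.
move/eqP; rewrite (eq_prim_root_expr hA) => /eqP h.
by rewrite -(modn_dvdm _ en) h modn_dvdm.
Qed.

Lemma dlog1 (e : nat) : (e %| #|F|.-1)%N -> dlog 1 = 0 %[mod e].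
Proof. by move=> en; rewrite -(expr0 A) dlog_pow. Qed.

Lemma dlogM (e : nat) (x y : F) : (e %| #|F|.-1)%N -> x != 0 -> y != 0 ->
  dlog (x * y) = dlog x + dlog y %[mod e].
Proof. by move=> en x0 y0; rewrite -{1}(dlogK x0) -{1}(dlogK y0) -exprD dlog_pow. Qed.

Lemma dlogX (e k : nat) (x : F) : (e %| #|F|.-1)%N -> x != 0 ->
  dlog (x ^+ k) = k * dlog x %[mod e].
Proof. by move=> en x0; rewrite -{1}(dlogK x0) -exprM mulnC dlog_pow. Qed.

Lemma expr_half_card : odd #|F| -> A ^+ (#|F|.-1)./2 = -1.
Proof.
move=> oF; have n0 := prim_order_gt0 hA.
have : (A ^+ (#|F|.-1)./2) ^+ 2 = 1.
  by rewrite -exprM -(prim_expr_order hA); congr (_ ^+ _); lia.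
move/eqP; rewrite sqrf_eq1 -(prim_order_dvd hA) => /orP[|/eqP //].
move=> dv; have h0 : (0 < (#|F|.-1)./2)%N by lia.
by have := dvdn_leq h0 dv; lia.
Qed.

Lemma dlogN (e : nat) (x : F) : (e %| #|F|.-1)%N -> odd #|F| -> x != 0 ->
  dlog (- x) = dlog x + (#|F|.-1)./2 %[mod e].
Proof.
move=> en oF x0; rewrite -mulN1r -(expr_half_card oF) dlogM ?expf_neq0 ?prim_root_neq0 //.
by rewrite -modnDml dlog_pow // modnDml addnC.
Qed.

Lemma sum_dlog (R : nmodType) (G : F -> R) :
  \sum_(x | x != 0) G x = \sum_(k < #|F|.-1) G (A ^+ k).
Proof.
rewrite (reindex_onto (fun k : 'I_(#|F|.-1) => A ^+ k)
  (fun x => insubd (Ordinal (prim_order_gt0 hA)) (dlog x))) /=.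
  apply: eq_bigl => k; rewrite expf_neq0 ?prim_root_neq0 //=; apply/eqP/val_inj.
  rewrite val_insubd dlog_lt; have := dlog_pow k (dvdnn _).
  by rewrite !modn_small ?dlog_lt.
by move=> x x0; rewrite val_insubd dlog_lt dlogK.
Qed.

(** For [w] of period [e] dividing [#|F|.-1], these are the functions that vanish at 0 and are
    constant on the cyclotomic classes of order [e]. *)
Definition index_fun (R : nmodType) (w : nat -> R) (x : F) : R :=
  if x == 0 then 0 else w (dlog x).

Lemma index_funE (R : nmodType) (w : nat -> R) (e k : nat) (x : F) :
  (e %| #|F|.-1)%N -> periodic e w -> x != 0 -> dlog x = k %[mod e] -> index_fun w x = w k.
Proof. by move=> en pw /negPf x0 h; rewrite /index_fun x0; apply: periodic_eq h. Qed.

Lemma sum_dlog_periodic (R : nmodType) (w : nat -> R) (e : nat) :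
  (e %| #|F|.-1)%N -> periodic e w ->
  \sum_(x | x != 0) w (dlog x) = (\sum_(i < e) w i) *+ (#|F|.-1 %/ e).
Proof.
move=> en pw; rewrite sum_dlog -sum_periodic // divnK //.
by apply: eq_bigr => k _; apply: (periodic_eq pw); rewrite dlog_pow.
Qed.

Lemma sum_index_fun (R : nmodType) (w : nat -> R) (e : nat) :
  (e %| #|F|.-1)%N -> periodic e w ->
  \sum_x index_fun w x = (\sum_(i < e) w i) *+ (#|F|.-1 %/ e).
Proof.
move=> en pw; rewrite -sum_dlog_periodic // [RHS]big_mkcond.
by apply: eq_bigr => x _; rewrite /index_fun; case: eqP.
Qed.

Definition index_set (c : nat -> bool) : {set F} := [set x | (x != 0) && c (dlog x)].

Lemma card_index_set (c : nat -> bool) (e : nat) : (e %| #|F|.-1)%N -> periodic e c ->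
  #|index_set c| = ((\sum_(i < e) c i) * (#|F|.-1 %/ e))%N.
Proof.
move=> en pc; have pc' : periodic e (fun k => nat_of_bool (c k)) by move=> k; rewrite pc.
have := sum_dlog_periodic en pc'; rewrite -mulr_natr natn => /= e1.
apply: etrans e1.
rewrite -sum1_card /index_set big_mkcond [RHS]big_mkcond; apply: eq_bigr => x _.
by rewrite inE; case: (x != 0); case: (c _).
Qed.

Lemma index_set0 (c : nat -> bool) : 0 \notin index_set c.
Proof. by rewrite inE eqxx. Qed.

Lemma balance_index_set (c : nat -> bool) :
  balance (index_set c) =1 index_fun (fun k => 2 * (c k)%:R - 1).
Proof. by move=> x; rewrite /balance /index_fun inE; case: eqP. Qed.

(** Substituting [x |-> A * x] multiplies the sum by [A ^+ s], which differs from 1 unless [#|F|.-1]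
    divides [s]. *)
Lemma sum_expr (s : nat) : (0 < s)%N ->
  \sum_(x : F) x ^+ s = if (#|F|.-1 %| s)%N then -1 else 0.
Proof.
move=> s0; have [/dvdnP[m sE]|ns] := boolP (_ %| _)%N; last first.
  apply/eqP; have : (A ^+ s - 1) * (\sum_(x : F) x ^+ s) = 0.
    rewrite mulrBl mul1r mulr_sumr [X in _ - X](reindex_inj (mulfI prim_root_neq0)) /=.
    by apply/eqP; rewrite subr_eq0; apply/eqP/eq_bigr => x _; rewrite exprMn.
  by move/eqP; rewrite mulf_eq0 subr_eq0 -(prim_order_dvd hA) (negPf ns).
rewrite (bigD1 0) //= expr0n gtn_eqF // add0r sE.
rewrite (eq_bigr (fun=> 1)) => [|x x0]; last by rewrite mulnC exprM expf_card1 ?expr1n.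
rewrite sumr_const; have -> : #|[pred x : F | x != 0]| = #|F|.-1.
  by rewrite -(cardC1 (0 : F)); apply: eq_card => d; rewrite !inE.
(* It remains that [#|F|] vanishes in [F]: the substitution [x |-> x + 1] adds it to the sum of all
   elements. *)
apply/eqP; rewrite -subr_eq0 opprK -mulrSr prednK; last by apply/card_gt0P; exists 0.
rewrite -(inj_eq (addrI (\sum_(x : F) x))) addr0 -sumr_const -big_split /=.
by rewrite [X in _ == X](reindex_inj (addIr 1)).
Qed.

End DiscreteLog.

(** * Cyclotomic classes described by discrete logarithms *)

Section Classes.
Import GRing.Theory.
Variables (F : finFieldType) (a : {unit F}).
Hypothesis ha : primitive_element a.

Lemma primitive_elementP : (#|F|.-1).-primitive_root%R (val a).
Proof.
have oa : #[a]%g = #|F|.-1.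
  by rewrite -card_finField_unit; move: ha; rewrite /primitive_element /generator => /eqP ->.
have n0 : 0 < #|F|.-1 by rewrite -oa order_gt0.
have oX k : (val a ^+ k == 1)%R = (#|F|.-1 %| k).
  by rewrite -FinRing.val_unitX -FinRing.val_unit1 (inj_eq val_inj) -order_dvdn oa.
apply/andP; split=> //; apply/forallP => i.
apply/eqP; rewrite unity_rootE oX; apply/idP/eqP => [/dvdn_leq le|->//].
by apply/eqP; rewrite eqn_leq le // ltn_ord.
Qed.

Lemma cyclotomic_classE (e i : nat) : e %| #|F|.-1 ->
  cyclotomic_class a e i = index_set (val a) (fun k => k == i %[mod e]).
Proof.
move=> en; have hA := primitive_elementP; apply/setP => x; rewrite inE.
apply/imsetP/andP => [[u /cycleP[k ->] ->]|[x0 /eqP xi]].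
  rewrite FinRing.val_unitX FinRing.val_unitX -exprM -exprD.
  rewrite (expf_neq0 _ (prim_root_neq0 hA)) (dlog_pow hA _ en).
  by rewrite addnC mulnC modnMDl.
(* Adding [#|F|.-1 * i] leaves the power of the generator unchanged and makes the exponent at least
   [i], as natural subtraction requires. *)
have [k hk] : exists k, dlog (val a) x + #|F|.-1 * i = i + e * k.
  have /dvdnP[c hc] : e %| dlog (val a) x + #|F|.-1 * i - i.
    rewrite -eqn_mod_dvd; last by rewrite (leq_trans _ (leq_addl _ _)) // leq_pmull //
      (prim_order_gt0 hA).
    by rewrite -modnDmr (eqP (dvdn_mulr i en)) addn0 xi.
  exists c; rewrite [e * c]mulnC -hc subnKC //.
  by rewrite (leq_trans _ (leq_addl _ _)) // leq_pmull // (prim_order_gt0 hA).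
exists ((a ^+ e) ^+ k)%g; first exact: mem_cycle.
rewrite !FinRing.val_unitX -exprM -exprD -hk exprD exprM (prim_expr_order hA) expr1n mulr1.
by rewrite (dlogK hA).
Qed.

End Classes.

(** * Multiplicative characters *)

Section Characters.
Import Order.TTheory GRing.Theory Num.Theory.
Local Open Scope ring_scope.
Variables (F : finFieldType) (A : F).
Hypothesis hA : (#|F|.-1).-primitive_root A.

Lemma divring_closed_predT : divring_closed (predT : {pred F}).
Proof. by []. Qed.

Lemma periodic_expr (R : pzRingType) (e : nat) (z : R) :
  z ^+ e = 1 -> periodic e (fun k => z ^+ k).
Proof. by move=> z1 k; rewrite [in RHS](divn_eq k e) exprD mulnC exprM z1 expr1n mul1r. Qed.

(** For a suitable root of unity [z], the multiplicative character sending [A] to [z]. The target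
    ring varies: [int] for the quadratic character, [algC] for the norm of a Jacobi sum, [F] itself
    for its reduction modulo [p]. *)
Definition chi (R : pzRingType) (z : R) : F -> R := index_fun A (fun k => z ^+ k).

Section Chi.
Variables (R : idomainType) (e : nat) (z : R).
Hypotheses (en : (e %| #|F|.-1)%N) (ze : z ^+ e = 1).
Let pz := periodic_expr ze.

Lemma chi0 : chi z 0 = 0.
Proof. by rewrite /chi /index_fun eqxx. Qed.

Lemma chi1 : chi z 1 = 1.
Proof.
by rewrite /chi (index_funE en pz (oner_neq0 _) (dlog1 hA en)).
Qed.

Lemma chiM x y : chi z (x * y) = chi z x * chi z y.
Proof.
have [->|x0] := eqVneq x 0; first by rewrite !mul0r chi0 mul0r.
have [->|y0] := eqVneq y 0; first by rewrite !mulr0 chi0 mulr0.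
rewrite /chi (index_funE en pz (k := dlog A x + dlog A y)) ?mulf_neq0 ?(dlogM hA) //.
by rewrite exprD /index_fun (negPf x0) (negPf y0).
Qed.

Lemma sum_chi : z != 1 -> \sum_x chi z x = 0.
Proof.
move=> z1; rewrite (sum_index_fun hA en pz).
have : (z - 1) * (\sum_(i < e) z ^+ i) = 0 by rewrite -subrX1 ze subrr.
by move/eqP; rewrite mulf_eq0 subr_eq0 (negPf z1) => /eqP ->; rewrite mul0rn.
Qed.

Variable z' : R.
Hypothesis zz : z * z' = 1.

Lemma chi_mulV x : chi z x * chi z' x = (x != 0)%:R.
Proof. by rewrite /chi /index_fun; case: eqP; rewrite ?mul0r // -exprMn zz expr1n. Qed.

Lemma chi_ratio x y : chi z x * chi z' y = chi z (x / y).
Proof.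
have [->|y0] := eqVneq y 0.
  by rewrite invr0 mulr0 chi0 /chi /index_fun eqxx mulr0.
rewrite -{1}(divfK y0 x) [LHS]mulrC [chi z (_ * y)]chiM mulrCA [chi z' y * _]mulrC.
by rewrite chi_mulV y0 mulr1.
Qed.

Lemma sum_chi_shift d : z != 1 -> d != 0 -> \sum_x chi z x * chi z' (x + d) = -1.
Proof.
move=> z1 d0; under eq_bigr do rewrite chi_ratio.
rewrite (sum_ratio (L := predT) divring_closed_predT) ?chi0 //.
by rewrite chi1 (eq_bigl xpredT) // sum_chi // sub0r.
Qed.

End Chi.

(** Scaling by [d] reduces to [d = 1], where the autocorrelation is a Jacobi sum up to the factor
    [chi z (-1)]. *)
Lemma acorr_chi (R : idomainType) (e : nat) (z : R) (d : F) :
  (e %| #|F|.-1)%N -> z ^+ e = 1 -> d != 0 ->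
  acorr (chi z) d = chi z d ^+ 2 * acorr (chi z) 1.
Proof.
move=> en ze d0; rewrite /acorr mulr_sumr (reindex_inj (mulfI d0)) /=.
apply: eq_bigr => x _; rewrite -[d in _ + d]mulr1 -mulrDr !(chiM en ze); ring.
Qed.

(* Average over d of acorr (chi z) d * acorr (chi z') d, computed in two ways. *)
Lemma jacobi_norm (R : idomainType) (e : nat) (z z' : R) :
  (e %| #|F|.-1)%N -> z ^+ e = 1 -> z * z' = 1 -> z ^+ 2 != 1 ->
  (#|F|.-1)%:R * (acorr (chi z) 1 * acorr (chi z') 1) = (#|F|.-1)%:R * #|F|%:R.
Proof.
move=> en ze zz z21; set J := acorr (chi z) 1; set J' := acorr (chi z') 1.
have z1 : z != 1 by apply: contraNneq z21 => ->; rewrite expr1n.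
have ze' : z' ^+ e = 1 by rewrite -[LHS]mul1r -ze -exprMn zz expr1n.
have zz' : z' * z = 1 by rewrite mulrC.
have z1' : z' != 1 by apply: contraNneq z1 => z'1; rewrite -zz z'1 mulr1.
have nE : \sum_(x : F) (x != 0)%:R = (#|F|.-1)%:R :> R.
  rewrite (bigD1 0) //= eqxx add0r (eq_bigr (fun=> 1)) => [|x ->//].
  rewrite sumr_const; congr (_ *+ _).
  by rewrite -(cardC1 (0 : F)); apply: eq_card => d; rewrite !inE.
(* Since [z ^+ 2 != 1], the squared character is nontrivial, so [d = 0] contributes nothing. *)
have J0 : acorr (chi z) 0 = 0.
  rewrite acorr0 (eq_bigr (chi (z ^+ 2))) => [|x _]; last first.
    by rewrite /chi /index_fun; case: eqP; rewrite ?mul0r // -exprM mulnC exprM expr2.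
  by rewrite (sum_chi en) // -exprM mulnC exprM ze expr1n.
have L : \sum_d acorr (chi z) d * acorr (chi z') d = (#|F|.-1)%:R * (J * J').
  rewrite -nE mulr_suml; apply: eq_bigr => d _.
  have [->|d0] := eqVneq d 0; first by rewrite J0 !mul0r.
  rewrite (acorr_chi en ze d0) (acorr_chi en ze' d0) -/J -/J' mul1r.
  have -> : chi z d ^+ 2 * J * (chi z' d ^+ 2 * J') = (chi z d * chi z' d) ^+ 2 * (J * J').
    by ring.
  by rewrite chi_mulV // d0 expr1n mul1r.
rewrite -L.
(* Shifts of a nontrivial character are orthogonal up to the constant -1, and that constant
   disappears later because the character sums to 0. *)
have K v w : \sum_d chi z (v + d) * chi z' (w + d) = #|F|%:R * (v == w)%:R - 1.
  rewrite (reindex_inj (addIr (- v))) /=; under eq_bigr do rewrite addrCA subrr addr0.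
  have [->|vw] := eqVneq v w.
    under eq_bigr do rewrite addrCA subrr addr0 chi_mulV //.
    by rewrite nE mulr1 -[in RHS](prednK (n := #|F|)) ?mulrSr ?addrK //; apply/card_gt0P; exists 0.
  under eq_bigr do rewrite addrCA.
  by rewrite mulr0 sub0r (sum_chi_shift en ze zz) // subr_eq0 eq_sym.
have -> : \sum_d acorr (chi z) d * acorr (chi z') d =
    \sum_v \sum_w chi z v * chi z' w * (#|F|%:R * (v == w)%:R - 1).
  under eq_bigr do rewrite /acorr mulr_suml.
  rewrite exchange_big; apply: eq_bigr => v _ /=.
  under eq_bigr do rewrite mulr_sumr.
  rewrite exchange_big; apply: eq_bigr => w _ /=.
  rewrite -K mulr_sumr; apply: eq_bigr => d _; ring.
have -> : \sum_v \sum_w chi z v * chi z' w * (#|F|%:R * (v == w)%:R - 1) =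
    \sum_v (chi z v * chi z' v * #|F|%:R - chi z v * \sum_w chi z' w).
  apply: eq_bigr => v _; rewrite mulr_sumr.
  under eq_bigr do rewrite mulrBr mulr1.
  rewrite sumrB; congr (_ - _).
  rewrite (bigD1 v) //= eqxx mulr1 big1 ?addr0 // => w; rewrite eq_sym => /negPf ->.
  by rewrite !mulr0.
rewrite (sum_chi en ze' z1') -nE mulr_suml; apply: eq_bigr => v _.
by rewrite chi_mulV // mulr0 subr0.
Qed.

(** The quadratic character is the difference of the indicators of [D0] and [D1], and the indicator
    of the nonzero elements is their sum. Adding the autocorrelations of these two functions, -1 and
    [#|F| - 2], cancels the cross terms. *)
Lemma delta_squares (d : F) : odd #|F| -> d != 0 ->
  (2 * (delta (index_set A (fun k => k == 0 %[mod 2])) d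
      + delta (index_set A (fun k => k == 1 %[mod 2])) d) + 3 = #|F|)%N.
Proof.
move=> oF d0; set D0 := index_set _ _; set D1 := index_set _ _.
have en : (2 %| #|F|.-1)%N by rewrite dvdn2; have := prim_order_gt0 hA; lia.
have m1 : (-1 : int) ^+ 2 = 1 by [].
have m11 : (-1 : int) * -1 = 1 by [].
have eta x : chi (-1 : int) x = (x \in D0)%:R - (x \in D1)%:R.
  rewrite /chi /index_fun !inE; case: eqP => //= _.
  by rewrite !modn2 -signr_odd; case: odd.
have nz (x : F) : (x != 0%R)%:R = (x \in D0)%:R + (x \in D1)%:R :> int.
  by rewrite !inE; case: eqP => //= _; rewrite !modn2; case: odd.
apply/eqP; rewrite -(eqr_nat int) natrD natrM natrD !deltaE; apply/eqP.
have : acorr (chi (-1 : int)) d + acorr (fun z => (z != 0%R)%:R) d =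
    2 * (acorr (fun z => (z \in D0)%:R) d + acorr (fun z => (z \in D1)%:R) d) :> int.
  rewrite /acorr -!big_split mulr_sumr /=; apply: eq_bigr => x _.
  by rewrite !eta !nz; ring.
rewrite acorr_nz // /acorr (sum_chi_shift en m1 m11) // => <-; ring.
Qed.

End Characters.

(** * Classes of order 4 *)

Section Order4Arith.

(** For odd [r] use [p ^ 2 = 1] modulo 4. For even [r] two squares would differ by 4, which forces
    [t = 0] and [p ^ r = 4]. *)
Lemma mod4_of_sqr_add4 (p r t : nat) :
  t ^ 2 + 4 = p ^ r -> p ^ r = 1 %[mod 4] -> p = 1 %[mod 4].
Proof.
move=> et e4; have r0 : 0 < r by case: r et {e4} => //; rewrite expn0; lia.
have op : odd p by have := oddX p r; rewrite (gtn_eqF r0) /=; lia.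
have [ev|od] := boolP (~~ odd r); last first.
  rewrite negbK in od; have rE : r = r./2.*2.+1 by lia.
  have p2 : (p ^ 2) %% 4 = 1.
    have : (p %% 4 == 1) || (p %% 4 == 3) by lia.
    by rewrite -modnXm => /orP[] /eqP ->.
  move: e4; rewrite rE expnS -mul2n expnM -modnMmr -modnXm p2 exp1n.
  by rewrite modnMmr muln1.
have rE : r = r./2 * 2 by lia.
move: et e4; rewrite rE expnM; move: (p ^ _) => m; rewrite -!mulnn => et e4; exfalso.
have [mt|mt] := leqP m t; first by nia.
have [c mc] : exists c, m = t + c.+1 by exists (m - t).-1; lia.
case: c mc => [|[|c]] mc; rewrite mc in et e4; [lia| |nia].
have t0 : t = 0 by lia.
by rewrite t0 in e4.
Qed.

(** The left side is a multiple of [P] below [4 * P] and congruent to 1 modulo 4, so the cofactor is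
    1. *)
Lemma modn_quarter (P f : nat) : P = 1 %[mod 4] -> P %| (4 * f).+1 -> 4 * (f %% P) + 1 = P.
Proof.
move=> P4 /dvdnP[w hw]; have P0 : 0 < P by case: P P4 hw.
have := ltn_pmod f P0; have := divn_eq f P; move: (f %/ P) (f %% P) => u v fE lt.
have : exists t, 4 * v + 1 = P * t.
  by exists (w - 4 * u); rewrite mulnBr; lia.
case=> -[|[|[|[|t]]]] e; move: P4; lia.
Qed.

End Order4Arith.

Section Order4.
Import Order.TTheory GRing.Theory Num.Theory.
Local Open Scope ring_scope.

Definition tab (s : seq int) (k : nat) : int := nth 0 s (k %% size s)%N.

Lemma periodic_tab (s : seq int) : periodic (size s) (tab s).
Proof. by move=> k; rewrite /tab modn_mod. Qed.

Lemma periodic2_forall (T : eqType) (e : nat) (u v : nat -> nat -> T) : (0 < e)%N ->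
  (forall i, periodic e (u i)) -> (forall j, periodic e (u^~ j)) ->
  (forall i, periodic e (v i)) -> (forall j, periodic e (v^~ j)) ->
  all (fun i => all (fun j => u i j == v i j) (iota 0 e)) (iota 0 e) -> forall i j, u i j = v i j.
Proof.
move=> e0 pu pu' pv pv' /allP h i j.
rewrite -(pu i) -(pu' _ i) -(pv i) -(pv' _ i).
have /h/allP/(_ (j %% e)%N) : (i %% e)%N \in iota 0 e by rewrite mem_iota ltn_mod.
by rewrite mem_iota ltn_mod => /(_ e0)/eqP.
Qed.

(* cos4 k and sin4 k are cos (k pi / 2) and sin (k pi / 2), and sgn4 = cos4 + sin4. *)
Definition cos4 := tab [:: 1; 0; -1; 0].
Definition sin4 := tab [:: 0; 1; 0; -1].
Definition sgn4 := tab [:: 1; 1; -1; -1].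

Lemma periodic_cos4 : periodic 4 cos4. Proof. exact: periodic_tab. Qed.
Lemma periodic_sin4 : periodic 4 sin4. Proof. exact: periodic_tab. Qed.
Lemma periodic_sgn4 : periodic 4 sgn4. Proof. exact: periodic_tab. Qed.

Lemma expr_sqr_neg1 (R : pzRingType) (z : R) (k : nat) : z ^+ 2 = -1 ->
  z ^+ k = (cos4 k)%:~R + (sin4 k)%:~R * z.
Proof.
move=> z2; have z4 : z ^+ 4 = 1 by rewrite -[4%N]/(2 * 2)%N exprM z2 sqrrN expr1n.
rewrite -[LHS](periodic_expr z4) /cos4 /sin4 /tab /=.
have : (k %% 4 < 4)%N by rewrite ltn_mod.
case: (k %% 4)%N => [|[|[|[|//]]]] _ /=; rewrite ?mul0r ?addr0 ?mul1r ?add0r ?rmorphN1 //.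
by rewrite exprS z2 mulrN1 mulN1r.
Qed.

(** The identity (cos x + sin x)(cos y + sin y) = sin(x + y) + cos(x - y) at the angles of indices
    [i + j] and [j]. *)
Lemma sgn4_mul (i j : nat) : sgn4 (i + j) * sgn4 j = sin4 (i + 2 * j) + cos4 i.
Proof.
have P := periodic_tab; move: i j; apply: (periodic2_forall (e := 4)) => //.
- by move=> i k; rewrite [sgn4 (i + _)](periodic_eq (P _) (modnDmr _ _ _)) [sgn4 (k %% 4)]P.
- by move=> j k; rewrite [sgn4 (_ + j)](periodic_eq (P _) (modnDml _ _ _)).
- move=> i k; congr (_ + _); apply: (periodic_eq (P _)).
  by rewrite -modnDmr modnMmr modnDmr.
by move=> j k; rewrite [sin4 (_ + _)](periodic_eq (P _) (modnDml _ _ _)) [cos4 (k %% 4)]P.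
Qed.

Lemma sin4_double (i j : nat) : sin4 (2 * i + j) = (-1) ^+ i * sin4 j.
Proof.
have P := periodic_tab; move: i j; apply: (periodic2_forall (e := 4)) => //.
- by move=> i k; apply: (periodic_eq (P _)); rewrite modnDmr.
- by move=> j k; apply: (periodic_eq (P _)); rewrite -modnDml modnMmr modnDml.
- by move=> i k; rewrite [sin4 (k %% 4)]P.
by move=> j k; rewrite (periodic_expr (e := 4)).
Qed.

Variables (F : finFieldType) (A : F).
Hypothesis hA : (#|F|.-1).-primitive_root A.
Variables (p r f : nat) (s : int).
Hypotheses (pp : prime p) (cF : #|F| = (p ^ r)%N) (nf : #|F|.-1 = (4 * f)%N) (fo : odd f).
Hypothesis hs : #|F|%:Z = s ^+ 2 + 4.

Let C := index_set A (fun k => (k %% 4 < 2)%N).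
(** [a] and [b] are, up to sign, the real and imaginary parts of the quartic Jacobi sum, kept as
    integers so that they map both to [algC] and to [F]. *)
Let a := \sum_(x : F) index_fun A cos4 (x * (x + 1)).
Let b := \sum_(x : F) index_fun A sin4 (x * (x + 1)).
Let en : (4 %| #|F|.-1)%N. Proof. by rewrite nf dvdn_mulr. Qed.
Let q4 : #|F| = (4 * f).+1. Proof. by rewrite -nf prednK //; apply/card_gt0P; exists 0. Qed.
Let oF : odd #|F|. Proof. by rewrite q4; lia. Qed.

Lemma acorr_chi_sqr_neg1 (R : idomainType) (z : R) : z ^+ 2 = -1 ->
  acorr (chi A z) 1 = a%:~R + b%:~R * z.
Proof.
move=> z2; have z4 : z ^+ 4 = 1 by rewrite -[4%N]/(2 * 2)%N exprM z2 sqrrN expr1n.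
rewrite /a /b !rmorph_sum mulr_suml -big_split; apply: eq_bigr => x _ /=.
rewrite -(chiM hA en z4) /chi /index_fun; case: eqP; first by rewrite mul0r addr0.
by move=> _; apply: expr_sqr_neg1.
Qed.

Lemma norm_order4 : a ^+ 2 + b ^+ 2 = #|F|%:Z.
Proof.
have i2 : ('i : algC) ^+ 2 = -1 by rewrite sqrCi.
have i4 : ('i : algC) ^+ 4 = 1 by rewrite -[4%N]/(2 * 2)%N exprM i2 sqrrN expr1n.
have i21 : ('i : algC) ^+ 2 != 1 by rewrite i2 eq_sym -addr_eq0 (pnatr_eq0 _ 2).
have ii : ('i : algC) * - 'i = 1 by rewrite mulrN -expr2 i2 opprK.
have n0 : (#|F|.-1)%:R != 0 :> algC by rewrite pnatr_eq0 -lt0n (prim_order_gt0 hA).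
have := mulfI n0 (jacobi_norm hA en i4 ii i21).
rewrite !acorr_chi_sqr_neg1 ?sqrrN // => h.
apply/eqP; rewrite -(eqr_int algC); apply/eqP.
rewrite rmorphD !rmorphXn /= -[RHS]h.
by rewrite mulrN [RHS]mulrC -subr_sqr exprMn i2 mulrN1 opprK.
Qed.

(** By [sgn4_mul] the product of the values at [x] and [y] is a function of [x * y] plus a function
    of [x / y]. With [y = x + d], the first scales to [b] up to sign, and the second sums to -1 by
    [sum_ratio]. *)
Lemma acorr_order4 (d : F) : d != 0 ->
  acorr (index_fun A sgn4) d = (-1) ^+ dlog A d * b - 1.
Proof.
move=> d0; have pt (x y : F) : index_fun A sgn4 x * index_fun A sgn4 y =
    index_fun A sin4 (x * y) + index_fun A cos4 (x / y).
  have [->|x0] := eqVneq x 0; first by rewrite !mul0r /index_fun eqxx mul0r.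
  have [->|y0] := eqVneq y 0; first by rewrite !(invr0, mulr0) /index_fun eqxx mulr0.
  set i := dlog A (x / y); set j := dlog A y.
  have xi : dlog A x = i + j %[mod 4] by rewrite -(dlogM hA) ?divfK ?mulf_neq0 ?invr_eq0.
  rewrite (index_funE en periodic_sgn4 x0 xi) (index_funE en periodic_sgn4 (k := j) y0) //.
  rewrite (index_funE en periodic_cos4 (k := i)) ?mulf_neq0 ?invr_eq0 //.
  rewrite (index_funE en periodic_sin4 (k := i + 2 * j)) ?mulf_neq0 //; first exact: sgn4_mul.
  by rewrite (dlogM hA) // -[LHS]modnDml xi modnDml mul2n -addnn addnA.
rewrite /acorr; under eq_bigr do rewrite pt.
rewrite big_split /=; congr (_ + _).
  rewrite /b mulr_sumr (reindex_inj (mulfI d0)); apply: eq_bigr => x _ /=.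
  have -> : d * x * (d * x + d) = d * d * (x * (x + 1)) by ring.
  have [->|x0] := eqVneq (x * (x + 1)) 0; first by rewrite mulr0 /index_fun eqxx mulr0.
  have dd0 := mulf_neq0 d0 d0; set j := dlog A (x * (x + 1)).
  rewrite (index_funE en periodic_sin4 (k := 2 * dlog A d + j)) ?(mulf_neq0 dd0 x0) //.
    by rewrite (index_funE en periodic_sin4 (k := j)) // sin4_double.
  by rewrite (dlogM hA en dd0 x0) -[LHS]modnDml (dlogM hA en d0 d0) modnDml mul2n -addnn.
rewrite (sum_ratio (L := predT) (divring_closed_predT F)) //; last by rewrite /index_fun eqxx.
rewrite (eq_bigl xpredT) // (sum_index_fun hA en periodic_cos4).
have -> : \sum_(i < 4) cos4 i = 0 by rewrite !big_ord_recl big_ord0.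
by rewrite mul0rn (index_funE en periodic_cos4 (oner_neq0 _) (dlog1 hA en)).
Qed.

Lemma delta_order4_val (d : F) : d != 0 ->
  4 * (delta C d)%:R = (-1) ^+ dlog A d * b + #|F|%:Z - 3.
Proof.
move=> d0; have pc : periodic 4 (fun k => (k %% 4 < 2)%N) by move=> k; rewrite modn_mod.
rewrite delta_balance ?index_set0 //; last first.
  rewrite (card_index_set hA en pc) !big_ord_recl big_ord0 nf q4 /= mulKn //.
  by rewrite mulnA.
have -> : acorr (balance C) d = acorr (index_fun A sgn4) d.
  apply: eq_bigr => x _; rewrite !balance_index_set /index_fun.
  have w k : 2 * (k %% 4 < 2)%N%:R - 1 = sgn4 k.
    by rewrite /sgn4 /tab /=; have := ltn_pmod k (isT : 0 < 4)%N;
      case: (k %% 4)%N => [|[|[|[|]]]].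
  by rewrite !w.
rewrite acorr_order4 //.
(* As [f] is odd, [-1] has index 2 modulo 4, so exactly one of [d] and [- d] lies in [C]. *)
have -> : - d \in C = (d \notin C).
  rewrite !inE oppr_eq0 d0 /= (dlogN hA en oF d0) nf.
  have -> : (4 * f)./2 = (2 + 4 * f./2)%N by lia.
  lia.
by case: (d \in C); rewrite /=; ring.
Qed.

(** If [p] divided [a] it would divide [b], by the norm equation, and the Jacobi sum would vanish in
    [F]. There it is a sum of [x ^+ (3 * f) * (x + 1) ^+ (3 * f)]; after expansion only the exponent
    [4 * f] survives, leaving [- 'C(3 * f, f)]. *)
Lemma prime_ndvd_cos4 : ~~ (p %| a)%Z.
Proof.
have pF : p \in [pchar F] by apply: card_finPcharP cF pp.
have q14 : #|F| = 1 %[mod 4] by rewrite q4 -addn1 mulnC modnMDl.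
have p4 : p = 1 %[mod 4].
  apply: (@mod4_of_sqr_add4 p r `|s|%N); rewrite -cF //.
  by apply/eqP; rewrite -eqz_nat hs PoszD -abszX; lia.
have r0 : (0 < r)%N by case: r cF q4; lia.
apply/negP => pa; have pb : (p %| b)%Z.
  have : (p %| b ^+ 2)%Z.
    have -> : b ^+ 2 = #|F|%:Z - a ^+ 2 by rewrite -norm_order4; ring.
    by rewrite rpredB ?dvdz_exp // cF dvdzE /= dvdn_exp.
  by rewrite !dvdzE abszX Euclid_dvdX // => /andP[].
have z0 (c : int) : (p %| c)%Z -> c%:~R = 0 :> F.
  by move/dvdzP=> [d ->]; rewrite intrM [p%:~R](pcharf0 pF) mulr0.
have [za zb] : a%:~R = 0 :> F /\ b%:~R = 0 :> F by split; apply: z0.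
have f0 : (0 < f)%N by move: fo; case: (f).
(* The choice of square root of -1 matters: [A ^+ f] would give polynomials of degree [2 * f], whose
   power sums all vanish. *)
pose z := A ^+ (3 * f).
have z2 : z ^+ 2 = -1.
  rewrite -(expr_half_card hA oF) /z nf -exprM.
  have -> : (3 * f * 2 = (4 * f)./2 + 4 * f)%N by lia.
  by rewrite exprD -nf (prim_expr_order hA) mulr1.
have := acorr_chi_sqr_neg1 z2; rewrite za zb mul0r addr0 => J0.
have chiE (x : F) : chi A z x = x ^+ (3 * f).
  rewrite /chi /index_fun; case: eqP => [->|/eqP x0].
    by rewrite expr0n muln_eq0 (gtn_eqF f0).
  by rewrite -[x in RHS](dlogK hA x0) /z -!exprM mulnC.
have : \sum_(x : F) \sum_(i < (3 * f).+1) 'C(3 * f, i)%:R * x ^+ (3 * f + i) = 0.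
  rewrite -[RHS]J0; apply: eq_bigr => x _; rewrite !chiE.
  rewrite addrC exprDn mulr_sumr; apply: eq_bigr => i _.
  by rewrite expr1n mul1r exprD -mulr_natl; ring.
rewrite exchange_big /=; under eq_bigr do rewrite -mulr_sumr.
have fl : (f < (3 * f).+1)%N by lia.
rewrite (bigD1 (Ordinal fl)) //= [X in _ + X]big1 ?addr0 => [|i /eqP ni]; last first.
  have nif : (i : nat) <> f by move=> e; apply: ni; apply: val_inj.
  have := ltn_ord i; rewrite (sum_expr hA) ?ifN ?mulr0 //; last by lia.
  by rewrite nf; apply/negP => /dvdnP[[|[|m]] hm]; have := ltn_ord i; lia.
rewrite (sum_expr hA) ?ifT; [|by rewrite nf; apply/dvdnP; exists 1; lia|by lia].
rewrite mulrN1 => /eqP; rewrite oppr_eq0 -(dvdn_pcharf pF) => /negPn; apply/negP.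
have -> : (3 * f = f + 2 * f)%N by lia.
rewrite negbK; apply: prime_ndvd_bin => // k.
(* For [k <= r] and [P = p ^ k], the residues of [f] and [2 * f] are [(P - 1) / 4] and
   [(P - 1) / 2]. For larger [k] both numbers are their own residues and the sum [3 * f] is below
   [p ^ k]. *)
have [kr|rk] := leqP k r.
  have P4 : (p ^ k)%N = 1 %[mod 4] by rewrite -modnXm p4 modnXm exp1n.
  have Pq : (p ^ k %| (4 * f).+1)%N by rewrite -q4 cF dvdn_exp2l.
  have := modn_quarter P4 Pq; rewrite mul2n -addnn -modnDm; move: (f %% _)%N => v.
  by move=> <-; rewrite modn_small; lia.
have lt : ((4 * f).+1 < p ^ k)%N by rewrite -q4 cF ltn_exp2l // prime_gt1.
by rewrite !modn_small; lia.
Qed.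

Lemma delta_order4 (d : F) : d != 0 ->
  (4 * delta C d + 5 = #|F| \/ 4 * delta C d + 1 = #|F|)%N.
Proof.
move=> d0.
have p2 : (p %| 2)%Z = false.
  apply/negP; rewrite dvdzE /= dvdn_divisors // inE => /orP[|]; rewrite ?inE => /eqP pE.
    by move: pp; rewrite pE.
  by have := oF; rewrite cF pE oddX orbF => /eqP r0; move: q4; rewrite cF r0 expn0; move: fo; lia.
have : b ^+ 2 = 2 ^+ 2 \/ (1 = 1 :> int /\ a ^+ 2 = 2 ^+ 2).
  apply: (norm_form_unique (k := 1) (s := s) pp (n := r)); rewrite ?mul1r -?cF ?norm_order4 //.
  by move: prime_ndvd_cos4 p2; rewrite !dvdzE !abszM !Euclid_dvdM // => /negPf -> /= ->.
(* The alternative [a ^+ 2 = 4] would make [b] odd, against divisibility by 4 in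
   [delta_order4_val]. *)
have := norm_order4; have := delta_order4_val d0; rewrite q4; move: fo.
rewrite -signr_odd; case: (odd (dlog A d)); rewrite ?expr1 ?expr0.
  by move: (delta C d) a b; clear; nia.
by move: (delta C d) a b; clear; nia.
Qed.

End Order4.

(** * The plane over the subfield with l elements *)

Section Plane.
Import Order.TTheory GRing.Theory Num.Theory.
Local Open Scope ring_scope.
Variables (F : finFieldType) (A : F).
Hypothesis hA : (#|F|.-1).-primitive_root A.
Variables (p r l : nat).
Hypotheses (pp : prime p) (lE : l = (p ^ r)%N) (cF : #|F| = (l ^ 2)%N).

Lemma frob_add (x y : F) : (x + y) ^+ l = x ^+ l + y ^+ l.
Proof.
have pF : p \in [pchar F] by apply: (card_finPcharP (n := r * 2)); rewrite // cF lE expnM.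
by apply: exprDn_pchar; rewrite lE (eq_pnat _ (pcharf_eq pF)) pnatX pnat_id.
Qed.

Lemma frob_gt1 : (1 < l)%N.
Proof. by have := finNzRing_gt1 F; rewrite cF; case: l => [|[|]]. Qed.

Let l0 : (0 < l)%N. Proof. exact: ltnW frob_gt1. Qed.

Lemma frob_opp (x : F) : (- x) ^+ l = - x ^+ l.
Proof.
apply/eqP; rewrite -addr_eq0 -frob_add addNr expr0n.
by rewrite (gtn_eqF l0).
Qed.

Lemma card_F_pred : #|F|.-1 = ((l + 1) * (l - 1))%N.
Proof. by rewrite cF; case: l l0 => // k _; clear; rewrite -mulnn; nia. Qed.

Definition fixed_field : {pred F} := [pred x | x ^+ l == x].
Local Notation L := fixed_field.

Lemma divring_closed_fixed : divring_closed L.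
Proof.
split=> [|x y|x y]; rewrite !inE ?expr1n //.
  by move=> /eqP xl /eqP yl; rewrite frob_add frob_opp xl yl.
by move=> /eqP xl /eqP yl; rewrite exprMn exprVn xl yl.
Qed.

Lemma fixed0 : 0 \in L.
Proof. by rewrite inE expr0n (gtn_eqF l0). Qed.

Lemma fixed1 : 1 \in L.
Proof. by rewrite inE expr1n. Qed.

Lemma dvdn_succ_card : (l + 1 %| #|F|.-1)%N.
Proof. by rewrite card_F_pred dvdn_mulr. Qed.

Lemma fixedE (x : F) : x != 0 -> (x \in L) = (l + 1 %| dlog A x)%N.
Proof.
move=> x0; have -> : (x \in L) = (x * x ^+ (l - 1) == x * 1).
  by rewrite inE mulr1 -exprS subn1 prednK.
rewrite (inj_eq (mulfI x0)) -{1}(dlogK hA x0) -exprM -(prim_order_dvd hA) card_F_pred.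
by rewrite dvdn_pmul2r // subn_gt0 frob_gt1.
Qed.

Lemma card_fixed : #|L| = l.
Proof.
have pc : periodic (l + 1) (fun k => (l + 1 %| k)%N).
  by move=> k; rewrite /dvdn modn_mod.
have -> : #|L| = (1 + #|index_set A (fun k => (l + 1 %| k)%N)|)%N.
  rewrite (cardD1 0) fixed0; congr (_ + _)%N; apply: eq_card => x.
  by rewrite !inE; have [//|x0] := eqVneq x 0; rewrite /= -(fixedE x0).
rewrite (card_index_set hA dvdn_succ_card pc) addn1 big_ord_recl /= ?dvdn0 big1 => [|i _].
  by rewrite addn0 mul1n card_F_pred addn1 mulKn // subnKC.
by rewrite /bump /= add1n gtnNdvd // ltnS.
Qed.

Lemma sum_const_fixed (R : nmodType) (x : R) :
  \sum_(e in L | e != 0) x = x *+ (l - 1).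
Proof.
rewrite sumr_const; congr (_ *+ _); rewrite -card_fixed [in RHS](cardD1 0) fixed0 add1n subn1 /=.
by apply: eq_card => e; rewrite !inE andbC.
Qed.

(** * Coordinates in a basis over the subfield, and homogeneous functions *)

Section Decomposition.
Variables d z0 : F.
Hypotheses (d0 : d != 0) (hz : z0 / d \notin L).

Let Linj (e e' c c' : F) : e \in L -> e' \in L -> c \in L -> c' \in L ->
  e * z0 + c * d = e' * z0 + c' * d -> e = e' /\ c = c'.
Proof.
have [_ LB LV] := divring_closed_fixed.
move=> eL e'L cL c'L h.
have h2 : (e - e') * z0 = (c' - c) * d.
  by apply/eqP; rewrite -subr_eq0; apply/eqP; have /eqP := h; rewrite -subr_eq0 => /eqP <-; ring.
have [ee|ee] := eqVneq e e'.
  by split=> //; apply/eqP; move/eqP: h2; rewrite ee subrr mul0r eq_sym mulf_eq0 (negPf d0) orbF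
    subr_eq0 eq_sym.
case/negP: hz; have e0 : e - e' != 0 by rewrite subr_eq0.
have -> : z0 / d = (c' - c) / (e - e').
  by apply/eqP; rewrite eqr_div // mulrC h2.
by apply: LV; apply: LB.
Qed.

(** The pair [z0], [d] is independent over [L], and [#|F| = l ^ 2] turns injectivity of the
    coordinates into bijectivity. *)
Lemma sum_plane_decomp (R : nmodType) (G : F -> R) :
  \sum_z G z = \sum_(e in L) \sum_(c in L) G (e * z0 + c * d).
Proof.
rewrite pair_big_dep /=.
pose h (u : F * F) := u.1 * z0 + u.2 * d.
have hI : {in [pred u : F * F | (u.1 \in L) && (u.2 \in L)] &, injective h}.
  move=> [e c] [e' c'] /andP[/= eL cL] /andP[/= e'L c'L] hh.
  by have [/= -> ->] := Linj eL e'L cL c'L hh.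
rewrite -(big_imset G hI); apply: eq_bigl => z; symmetry.
suff -> : [set h u | u in [pred u : F * F | (u.1 \in L) && (u.2 \in L)]] = setT by rewrite inE.
apply/eqP; rewrite eqEcard subsetT cardsT (card_in_imset hI) cF.
rewrite -mulnn -{1}card_fixed -card_fixed -cardX; apply: eq_leq; apply: eq_card => u.
by rewrite !inE.
Qed.

(** [sg] is a sign character on the nonzero elements of [L] and [f] is homogeneous for it. It is
    trivial for functions constant on lines, and it is the odd function itself in order 8. *)
Variables (f sg : F -> int).
Hypotheses (sg0 : sg 0 = 0) (sg2 : forall c, c \in L -> c != 0 -> sg c ^+ 2 = 1).
Hypothesis sgM : forall x y, x \in L -> y \in L -> sg (x * y) = sg x * sg y.
Hypothesis fsg : forall c z, c \in L -> f (c * z) = sg c * f z.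

Let T := \sum_(c in L) f (z0 + c * d).
Let S2 := \sum_(c in L) f (z0 + c * d) ^+ 2.

Lemma sum_line_scale (R : nmodType) (G : F -> R) (e : F) : e \in L -> e != 0 ->
  \sum_(c in L) G (e * z0 + c * d) = \sum_(c in L) G (e * (z0 + c * d)).
Proof.
have [_ LB LV] := divring_closed_fixed.
move=> eL e0; rewrite (reindex_inj (mulfI e0)) /=; apply: eq_big => [c|c _].
  apply/idP/idP => [h|cL]; first by rewrite -(mulKf e0 c) mulrC LV.
  by rewrite -[e]invrK mulrC LV // -[_^-1]mul1r LV ?fixed1.
by rewrite mulrDr mulrA.
Qed.

(** The coefficient [e = 0] gives the line of [d]; by homogeneity every other parallel line reduces
    to the one through [z0]. *)
Lemma sum_plane : \sum_z f z = (\sum_(c in L) sg c) * (f d + T).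
Proof.
rewrite sum_plane_decomp (bigD1 0) ?fixed0 //= mulrDr mulr_suml; congr (_ + _).
  by apply: eq_bigr => c cL; rewrite mul0r add0r fsg.
rewrite [in RHS](bigD1 0) ?fixed0 //= sg0 add0r mulr_suml.
apply: eq_bigr => e /andP[eL e0]; rewrite sum_line_scale // mulr_sumr.
by apply: eq_bigr => c cL; rewrite fsg.
Qed.

Lemma sum_sqr_plane : \sum_z f z ^+ 2 = (f d ^+ 2 + S2) *+ (l - 1).
Proof.
have f0 : f 0 = 0 by rewrite -(mul0r 0) fsg ?fixed0 // sg0 mul0r.
rewrite sum_plane_decomp (bigD1 0) ?fixed0 //= mulrnDl; congr (_ + _).
  rewrite (bigD1 0) ?fixed0 //= !mul0r add0r f0 expr0n add0r.
  rewrite (eq_bigr (fun=> f d ^+ 2)) ?sum_const_fixed // => c /andP[cL c0].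
  by rewrite ?mul0r add0r fsg // exprMn sg2 // mul1r.
rewrite (eq_bigr (fun=> S2)) ?sum_const_fixed // => e /andP[eL e0].
rewrite (sum_line_scale (fun z => f z ^+ 2)) //.
by apply: eq_bigr => c cL; rewrite fsg // exprMn sg2 // mul1r.
Qed.

(* Off the line of d one has z = e * (z0 + c * d) with e in L^*, and then
   z + d = e * (z0 + (c + e^-1) * d): the pairs (e, c) describe the ordered pairs of distinct
   points of the affine line z0 + L * d, which gives T^2 - S2. *)
Lemma acorr_plane :
  acorr f d = f d ^+ 2 * (\sum_(c in L) sg c - 1) + T ^+ 2 - S2.
Proof.
have [_ LB LV] := divring_closed_fixed.
have LN1 : -1 \in L by rewrite -[X in X \in _]sub0r LB ?fixed0 ?fixed1.
have LD1 c : c \in L -> c + 1 \in L by move=> cL; rewrite -[1]opprK LB.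
have LVi c : c \in L -> c^-1 \in L by move=> cL; rewrite -[_^-1]mul1r LV ?fixed1.
have s1 : sg 1 = 1.
  have := sg2 fixed1 (oner_neq0 _); have := sgM fixed1 fixed1.
  by rewrite mulr1 expr2 => <-.
rewrite /acorr sum_plane_decomp (bigD1 0) ?fixed0 //= -addrA; congr (_ + _).
  (* On the line of [d] the terms are [sg (c / (c + 1)) * f d ^+ 2]. *)
  rewrite -s1 -(sum_ratio (L := L) divring_closed_fixed fixed1 (oner_neq0 _) sg0) mulr_sumr.
  apply: eq_bigr => c cL; rewrite mul0r add0r.
  have -> : c * d + d = (c + 1) * d by rewrite mulrDl mul1r.
  rewrite !fsg ?LD1 //.
  have [c10|c10] := eqVneq (c + 1) 0; first by rewrite c10 invr0 mulr0 sg0 !(mul0r, mulr0).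
  have -> : sg c = sg (c / (c + 1)) * sg (c + 1) by rewrite -sgM ?LV ?LD1 // divfK.
  rewrite -[RHS]mulr1 -(sg2 (LD1 _ cL) c10); ring.
have E (e : F) : e \in L -> e != 0 ->
    \sum_(c in L) f (e * z0 + c * d) * f (e * z0 + c * d + d) =
    \sum_(c in L) f (z0 + c * d) * f (z0 + (c + e^-1) * d).
  move=> eL e0; rewrite (sum_line_scale (fun z => f z * f (z + d))) //; apply: eq_bigr => c cL.
  have -> : e * (z0 + c * d) + d = e * (z0 + (c + e^-1) * d).
    by rewrite [(c + _) * d]mulrDl !mulrDr mulVKf // addrA.
  by rewrite !fsg // mulrACA -expr2 sg2 // mul1r.
rewrite (eq_bigr _ (fun e h => E e (proj1 (andP h)) (proj2 (andP h)))).
rewrite exchange_big /= expr2 {1}/T mulr_suml /S2 -sumrB; apply: eq_bigr => c cL.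
rewrite -mulr_sumr expr2 -mulrBr; congr (_ * _).
have invI : injective (@GRing.inv F) := invr_inj.
(* With [0^-1 = 0], inversion permutes all of [L]; the term [e = 0], the point [z0 + c * d] paired
   with itself, is then split off. *)
have -> : T = \sum_(e in L) f (z0 + (c + e^-1) * d).
  rewrite /T (reindex_inj (addrI c)) /= (reindex_inj invI) /=; apply: eq_bigl => e.
  apply/idP/idP => h; last by rewrite -[_^-1]opprK LB // -[- _]sub0r LB ?fixed0 // LVi.
  rewrite -[e]invrK LVi // -[_^-1](addKr c) addrC LB //.
by rewrite [in RHS](bigD1 0) ?fixed0 //= invr0 addr0 addrAC subrr add0r.
Qed.

End Decomposition.
End Plane.

(** * Functions constant on lines through the origin, and case (3) *)

Section Lines.
Import Order.TTheory GRing.Theory Num.Theory.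
Local Open Scope ring_scope.
Variables (F : finFieldType) (A : F).
Hypothesis hA : (#|F|.-1).-primitive_root A.
Variables (p r l : nat).
Hypotheses (pp : prime p) (lE : l = (p ^ r)%N) (cF : #|F| = (l ^ 2)%N) (ol : odd l).
Local Notation L := (@fixed_field F l).

Let l1 : (1 < l)%N. Proof. exact: (frob_gt1 cF). Qed.
Let en : (l + 1 %| #|F|.-1)%N. Proof. exact: (dvdn_succ_card cF). Qed.
Let l0 : ((l - 1)%:R : int) != 0. Proof. by rewrite pnatr_eq0 -lt0n subn_gt0. Qed.

(** Apply [acorr_plane] with [sg] equal to 1 off 0. The zero total forces [T = - f d], and the total
    of squares gives [S2]. *)
Lemma acorr_lines (w : nat -> int) (d : F) : periodic (l + 1) w ->
  \sum_(i < l + 1) w i = 0 -> d != 0 ->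
  acorr (index_fun A w) d = l%:Z * w (dlog A d) ^+ 2 - \sum_(i < l + 1) w i ^+ 2.
Proof.
move=> pw w0 d0; set f := index_fun A w.
have pw2 : periodic (l + 1) (fun k => w k ^+ 2) by move=> k; rewrite pw.
have fd : f d = w (dlog A d) by rewrite /f /index_fun (negPf d0).
pose sg (c : F) : int := (c != 0)%:R.
have sg0 : sg 0 = 0 by rewrite /sg eqxx.
have sg2 c : c \in L -> c != 0 -> sg c ^+ 2 = 1 by rewrite /sg => _ ->.
have sgM x y : x \in L -> y \in L -> sg (x * y) = sg x * sg y.
  by move=> _ _; rewrite /sg mulf_eq0 negb_or -natrM mulnb.
have fsg c z : c \in L -> f (c * z) = sg c * f z.
  have [->|c0] := eqVneq c 0; first by rewrite mul0r sg0 mul0r /f /index_fun eqxx.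
  have [->|z0] := eqVneq z 0; first by rewrite mulr0 /f /index_fun eqxx mulr0.
  rewrite (fixedE hA cF c0) => cL; rewrite /sg c0 mul1r /f.
  rewrite !(index_funE en pw (k := dlog A z)) ?mulf_neq0 //.
  by rewrite (dlogM hA) // -modnDml (eqP cL).
have hz : A * d / d \notin L.
  rewrite mulfK // (fixedE hA cF (prim_root_neq0 hA)) /dvdn -[A in dlog _ A]expr1.
  by rewrite (dlog_pow hA 1 en) modn_small //; lia.
have sgL : \sum_(c in L) sg c = (l - 1)%:R.
  rewrite (bigD1 0) ?(fixed0 cF) //= sg0 add0r (eq_bigr (fun=> 1)); last first.
    by move=> c /andP[_ c0]; rewrite /sg c0.
  by rewrite (sum_const_fixed hA cF).
have e1 := sum_plane hA pp lE cF d0 hz sg0 fsg.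
have e2 := sum_sqr_plane hA pp lE cF d0 hz sg0 sg2 fsg.
have e3 := acorr_plane hA pp lE cF d0 hz sg0 sg2 sgM fsg.
rewrite (sum_index_fun hA en pw) w0 mul0rn sgL in e1.
have sq : \sum_z f z ^+ 2 = (\sum_(i < l + 1) w i ^+ 2) *+ (l - 1).
  have <- : (#|F|.-1 %/ (l + 1) = l - 1)%N by rewrite (card_F_pred cF) mulKn ?addn1.
  rewrite -(sum_index_fun hA en pw2); apply: eq_bigr => x _.
  by rewrite /f /index_fun; case: eqP; rewrite ?expr0n.
have lE1 : (l - 1)%:R = l%:Z - 1 by rewrite (natrB _ (ltnW l1)) natz.
move: e1 e2 e3; rewrite sq sgL -fd.
move: (\sum_(c in L) f _) (\sum_(c in L) _ ^+ 2) (\sum_(i < _) _ ^+ 2) => T S2 S e1 e2 ->.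
have -> : S = f d ^+ 2 + S2 by apply: (mulIf l0); rewrite !mulr_natr.
have -> : T = - f d.
  by apply/eqP; rewrite -addr_eq0 addrC; move/esym/eqP: e1; rewrite mulf_eq0 (negPf l0).
rewrite lE1; move: (f d) => u; ring.
Qed.

(** For values 1 and -1 the autocorrelation is [l - (l + 1) = -1]. Since [- d] lies on the line of
    [d], only the membership of [d] in [C] matters. *)
Lemma delta_lines (c : nat -> bool) (d : F) : periodic (l + 1) c ->
  (\sum_(i < l + 1) c i = (l + 1) %/ 2)%N -> d != 0 ->
  (4 * delta (index_set A c) d + 5 = #|F| \/ 4 * delta (index_set A c) d + 1 = #|F|)%N.
Proof.
move=> pc c2 d0; set w := fun k => 2 * (c k)%:R - 1 : int.
have pw : periodic (l + 1) w by move=> k; rewrite /w pc.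
have oF : odd #|F| by rewrite cF oddX ol orbT.
have w0 : \sum_(i < l + 1) w i = 0.
  rewrite /w sumrB -mulr_sumr -natr_sum c2 sumr_const card_ord.
  by lia.
have w2 k : w k ^+ 2 = 1 by rewrite /w; case: (c k).
have acE : acorr (balance (index_set A c)) d = -1.
  have -> : acorr (balance (index_set A c)) d = acorr (index_fun A w) d.
    by apply: eq_bigr => x _; rewrite !balance_index_set.
  rewrite (acorr_lines pw w0 d0) (eq_bigr (fun=> 1)) ?w2 // sumr_const card_ord; lia.
have cE : - d \in index_set A c = (d \in index_set A c).
  rewrite !inE oppr_eq0 d0 /= -pc -[in RHS]pc; congr (c _).
  rewrite (dlogN hA en oF d0) (card_F_pred cF).
  have -> : (((l + 1) * (l - 1))./2 = (l + 1) * (l - 1)./2)%N.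
    have ev : odd (l - 1) = false by lia.
    by rewrite -[in LHS](odd_double_half (l - 1)) ev add0n -doubleMr doubleK.
  by rewrite -modnDmr modnMr addn0.
have := delta_balance (index_set0 A c) _ d0; rewrite acE cE.
rewrite (card_index_set hA en pc) c2 (card_F_pred cF) mulKn ?addn1 // => dE.
have {}dE := dE _.
have : (4 * (delta (index_set A c) d))%:R = -1 + #|F|%:R - 4 * (d \in index_set A c)%:R :> int.
  rewrite natrM dE; first by ring.
  rewrite cF; move: ol l1; clear; move: l => m; rewrite -mulnn => om m1.
  have -> : (2 * (m.+1 %/ 2 * (m - 1)) = m.+1 * (m - 1))%N.
    by rewrite mulnA; congr (_ * _)%N; lia.
  nia.
case: (d \in _); move: (delta _ _) (#|F|) => D Q; lia.
Qed.

End Lines.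

(** * Classes of order 8 *)

Section Order8Arith.

(** Odd squares are 1 modulo 8, so [r] is odd and [p ^ r] is congruent to [p]. *)
Lemma pow_mod8 (p r : nat) : p ^ r = 3 %[mod 8] -> p = 3 %[mod 8].
Proof.
move=> e; have r0 : 0 < r by case: r e.
have op : odd p by have := oddX p r; rewrite (gtn_eqF r0) /=; lia.
have p2 : (p ^ 2) %% 8 = 1.
  have : [|| p %% 8 == 1, p %% 8 == 3, p %% 8 == 5 | p %% 8 == 7] by lia.
  by rewrite -modnXm => /or4P[] /eqP ->.
have p2k k : (p ^ (k * 2)) %% 8 = 1 by rewrite mulnC expnM -modnXm p2 exp1n.
have [od|ev] := boolP (odd r); last first.
  by have rE : r = r./2 * 2 by [lia]; move: e; rewrite rE p2k.
have rE : r = (r./2 * 2).+1 by lia.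
by move: e; rewrite rE expnS -modnMmr p2k muln1.
Qed.

Lemma pow3_mod8 (p k : nat) : p = 3 %[mod 8] -> (p ^ k) %% 8 = 1 \/ (p ^ k) %% 8 = 3.
Proof.
move=> p3; elim: k => [|k [IH|IH]]; first by left.
  by right; rewrite expnS -modnMmr IH muln1 p3.
by left; rewrite expnS -modnMmr IH -modnMml p3.
Qed.

(** The residues satisfy [8 * v + 1 = P * s] and [8 * v' + 3 = P * s'] with [s] and [s'] below 8.
    Modulo 8 these cofactors are 1 and 3 in some order, hence [8 * (v + v') + 4 = 4 * P]. *)
Lemma no_carry_mod8 (P i j : nat) : P %% 8 = 1 \/ P %% 8 = 3 ->
  P %| 8 * i + 1 -> P %| 8 * j + 3 -> i %% P + j %% P < P.
Proof.
move=> P8 /dvdnP[w hw] /dvdnP[w' hw']; have P0 : 0 < P by case: P P8 {hw hw'} => [|P] //= [].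
have ltv := ltn_pmod i P0; have ltv' := ltn_pmod j P0.
have := divn_eq i P; move: (i %/ P) (i %% P) ltv => u v ltv iE.
have := divn_eq j P; move: (j %/ P) (j %% P) ltv' => u' v' ltv' jE.
have [s hs] : exists s, 8 * v + 1 = P * s by exists (w - 8 * u); rewrite mulnBr; lia.
have [s' hs'] : exists s, 8 * v' + 3 = P * s by exists (w' - 8 * u'); rewrite mulnBr; lia.
have s8 : s < 8 by rewrite -(ltn_pmul2l P0) -hs; lia.
have s8' : s' < 8 by rewrite -(ltn_pmul2l P0) -hs'; lia.
have [sE sE'] : (s = if P %% 8 == 1 then 1 else 3) /\ (s' = if P %% 8 == 1 then 3 else 1).
  split; clear - P8 hs hs' s8 s8'; case: P8 => P8; rewrite P8 /=.
  - by case: s hs s8 => [|[|[|[|[|[|[|[|s]]]]]]]] //; lia.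
  - by case: s hs s8 => [|[|[|[|[|[|[|[|s]]]]]]]] //; lia.
  - by case: s' hs' s8' => [|[|[|[|[|[|[|[|s']]]]]]]] //; lia.
  by case: s' hs' s8' => [|[|[|[|[|[|[|[|s']]]]]]]] //; lia.
move: hs hs'; rewrite sE sE'; case: eqP => _; lia.
Qed.

End Order8Arith.

(** * The odd part in order 8 and its sums over affine lines *)

Section Order8.
Import Order.TTheory GRing.Theory Num.Theory.
Local Open Scope ring_scope.

(* The function equal to 1 on D_0, D_1, D_2, D_5 and to -1 on the other classes is
   sin4 + sgn8, its even and odd parts under x |-> - x. *)
Definition sgn8 := tab [:: 1; 0; 1; 0; -1; 0; -1; 0].
(** It has one index from each of the pairs 1, 7 and 3, 5 exchanged by [j |-> 3 * j + 4]; adding its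
    image gives [sgn8 (j + 1)], whence the factor 2 in [line_sum1]. *)
Definition odd8 := tab [:: 0; 1; 0; -1; 0; 0; 0; 0].

Lemma periodic_sgn8 : periodic 8 sgn8. Proof. exact: periodic_tab. Qed.
Lemma periodic_odd8 : periodic 8 odd8. Proof. exact: periodic_tab. Qed.

Lemma sgn8_mul (i j : nat) : (4 %| i)%N -> sgn8 (i + j) = sgn8 i * sgn8 j.
Proof.
move=> /dvdnP[k ->]; rewrite [(k * 4)%N]mulnC; move: k j.
have P := periodic_sgn8; apply: (periodic2_forall (e := 8)) => //.
- by move=> k j'; apply: (periodic_eq P); rewrite modnDmr.
- by move=> j' k; apply: (periodic_eq P); rewrite -modnDml modnMmr modnDml.
- by move=> k j'; rewrite P.
by move=> j' k; congr (_ * _); apply: (periodic_eq P); rewrite modnMmr.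
Qed.

Lemma sgn8_sqr (i : nat) : sgn8 i ^+ 2 = (~~ odd i)%:R.
Proof.
move: i; apply: (periodic_forall (e := 8)) => // k; first by rewrite periodic_sgn8.
by rewrite odd_mod.
Qed.

Variables (F : finFieldType) (A : F).
Hypothesis hA : (#|F|.-1).-primitive_root A.
Variables (p r l n : nat).
Hypotheses (pp : prime p) (lE : l = (p ^ r)%N) (cF : #|F| = (l ^ 2)%N).
Hypotheses (ln : (l + 1 = 4 * n)%N) (on : odd n).
Local Notation L := (@fixed_field F l).

Let n0 : (0 < n)%N. Proof. exact: odd_gt0. Qed.
Let cF1 : #|F|.-1 = (8 * (n * (2 * n - 1)))%N.
Proof. rewrite (card_F_pred cF); move: n0 ln; clear; nia. Qed.
Let en : (8 %| #|F|.-1)%N. Proof. by rewrite cF1 dvdn_mulr. Qed.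
Let oF : odd #|F|. Proof. by rewrite cF oddX; apply/orP; right; move: ln; clear; lia. Qed.
Let half8 : (#|F|.-1)./2 = 4 %[mod 8].
Proof.
have [k nk] : exists k, n = k.*2.+1 by exists n./2; move: on; clear; lia.
rewrite cF1 nk; have -> : (8 * (k.*2.+1 * (2 * k.*2.+1 - 1)) = ((4 * k * k + 3 * k) * 8 + 4).*2)%N.
  by clear; nia.
by rewrite doubleK modnMDl.
Qed.

Lemma dlogN8 (x : F) : x != 0 -> dlog A (- x) = dlog A x + 4 %[mod 8].
Proof. by move=> x0; rewrite (dlogN hA en oF x0) -modnDmr half8 modnDmr. Qed.

Lemma two_neq0 : 2 != 0 :> F.
Proof.
have -> : (2 : F) = 1 - (-1) by rewrite opprK.
rewrite subr_eq0 -(expr_half_card hA oF) -(expr0 A) (eq_prim_root_expr hA).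
by rewrite mod0n modn_small; move: (prim_order_gt0 hA) cF1; clear; lia.
Qed.

Lemma fixed_dlog4 (c : F) : c != 0 -> c \in L -> (4 %| dlog A c)%N.
Proof.
move=> c0; rewrite (fixedE hA cF c0); apply: dvdn_trans.
by rewrite ln dvdn_mulr.
Qed.

Let g := index_fun A sgn8.

Lemma sgn8_homog (c z : F) : c \in L -> g (c * z) = g c * g z.
Proof.
have [->|c0] := eqVneq c 0; first by rewrite mul0r /g /index_fun eqxx mul0r.
have [->|z0] := eqVneq z 0; first by rewrite mulr0 /g /index_fun eqxx mulr0.
move=> cL; rewrite /g (index_funE en periodic_sgn8 (k := dlog A c + dlog A z)) ?mulf_neq0 //.
  by rewrite sgn8_mul ?fixed_dlog4 // /index_fun (negPf c0) (negPf z0).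
by rewrite (dlogM hA).
Qed.

Lemma sgn8_opp (z : F) : g (- z) = - g z.
Proof.
have [->|z0] := eqVneq z 0; first by rewrite oppr0 /g /index_fun eqxx oppr0.
rewrite /g (index_funE en periodic_sgn8 (k := 4 + dlog A z)) ?oppr_eq0 //.
  by rewrite sgn8_mul // /index_fun (negPf z0) mulN1r.
by rewrite dlogN8 // addnC.
Qed.

(** A square root of the generator [A ^+ (l + 1)] of the nonzero elements of [L]; thus [y] lies off
    [L] and Frobenius negates it. *)
Let y := A ^+ (2 * n).

Lemma frob_y : y ^+ l = - y.
Proof.
have l0 : (0 < l)%N by move: ln; clear; lia.
rewrite -[in LHS](prednK l0) exprS -[RHS]mulrN1 /y -exprM -(expr_half_card hA oF).
by congr (_ * A ^+ _); rewrite (card_F_pred cF) ln subn1 -[(4 * n)%N]/(2 * 2 * n)%N; clear; lia.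
Qed.

Lemma y_notin_fixed : y \notin L.
Proof.
rewrite inE frob_y eq_sym -subr_eq0 opprK -mulr2n -mulr_natl mulf_eq0 (negPf two_neq0).
by rewrite expf_neq0 ?(prim_root_neq0 hA).
Qed.

Lemma y_add_neq0 (c : F) : c \in L -> y + c != 0.
Proof.
move=> cL; apply: contraNneq y_notin_fixed => /eqP; rewrite addr_eq0 => /eqP ->.
by have [_ LB _] := divring_closed_fixed pp lE cF; rewrite -[- c]sub0r LB ?(fixed0 cF).
Qed.

Definition line_sum (R : nmodType) (w : nat -> R) : R := \sum_(c in L) w (dlog A (y + c)).

Lemma line_sumD (R : nmodType) (w w' : nat -> R) :
  line_sum (fun j => w j + w' j) = line_sum w + line_sum w'.
Proof. exact: big_split. Qed.

(* The map y + c |-> - (y + c)^l = y - c permutes the line and acts by j |-> 3 j + 4 on indices. *)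
Lemma line_sum_conj (R : nmodType) (w : nat -> R) : periodic 8 w ->
  line_sum w = line_sum (fun j => w (3 * j + 4)%N).
Proof.
move=> pw; have [_ LB _] := divring_closed_fixed pp lE cF.
have LN c : (- c \in L) = (c \in L).
  by apply/idP/idP => h; [rewrite -[c]opprK -[- - c]sub0r LB|rewrite -sub0r LB];
    rewrite ?(fixed0 cF).
rewrite /line_sum (reindex_inj oppr_inj) /= (eq_bigl _ _ LN); apply: eq_bigr => c cL.
apply: (periodic_eq pw).
have -> : y - c = - (y + c) ^+ l.
  by rewrite (frob_add pp lE cF) frob_y (eqP cL) opprD opprK.
have yc := y_add_neq0 cL; rewrite dlogN8 ?expf_neq0 // -[LHS]modnDml (dlogX hA) // modnDml.
have -> : (l = 3 + 8 * n./2)%N by move: ln on; clear; lia.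
move: (dlog A _) n./2 => D k; have -> : ((3 + 8 * k) * D + 4 = k * D * 8 + (3 * D + 4))%N by ring.
by rewrite modnMDl.
Qed.

(** For [d] of index [k] modulo 8, the sum of [g] over the affine line [y * d + L * d]. *)
Let T (k : nat) : int := line_sum (fun j => sgn8 (j + k)).

Let periodic_shift k : periodic 8 (fun j => sgn8 (j + k)).
Proof. by move=> j; apply: (periodic_eq periodic_sgn8); rewrite modnDml. Qed.

(** Symmetrising under conjugation of the line reduces relations between the [T k] to comparisons of
    tables of length 8. *)
Let T_double k : T k + T k = line_sum (fun j => sgn8 (j + k) + sgn8 (3 * j + 4 + k)).
Proof. by rewrite {2}/T (line_sum_conj (periodic_shift k)) -line_sumD. Qed.

Let int_double (u v : int) : u + u = v + v -> u = v. Proof. clear; lia. Qed.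

Let line_sum_ext (R : nmodType) (w w' : nat -> R) : w =1 w' -> line_sum w = line_sum w'.
Proof. by move=> e; apply: eq_bigr => c _; apply: e. Qed.

Let line_sum0 (R : nmodType) : line_sum (fun=> 0) = 0 :> R.
Proof. exact: big1. Qed.

Let line_sumN (w : nat -> int) : line_sum (fun j => - w j) = - line_sum w.
Proof. exact: sumrN. Qed.

Let sym_periodic (w : nat -> int) :
  periodic 8 w -> periodic 8 (fun j => w j + w (3 * j + 4)%N).
Proof. by move=> pw j; rewrite pw (periodic_comp 3 4 pw). Qed.

Let sym_shift k : periodic 8 (fun j => sgn8 (j + k) + sgn8 (3 * j + 4 + k)).
Proof. exact: (sym_periodic (periodic_shift k)). Qed.

Lemma line_sum_periodic k : T (k %% 8) = T k.
Proof.
by apply: line_sum_ext => j; apply: (periodic_eq periodic_sgn8); rewrite modnDmr.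
Qed.

Lemma line_sum_shift4 k : T (k + 4) = - T k.
Proof.
rewrite /T -sumrN; apply: eq_bigr => c _.
by rewrite addnA addnC sgn8_mul // mulN1r.
Qed.

Lemma line_sum2 : T 2 = - T 0.
Proof.
apply: int_double; rewrite -opprD !T_double -line_sumN; apply: line_sum_ext.
apply: (periodic_forall (e := 8)) => // j; exact: (congr1 -%R (sym_shift 0 j)).
Qed.

Lemma line_sum3 : T 3 = 0.
Proof.
apply: int_double; rewrite T_double addr0 -[RHS](line_sum0 int).
apply: line_sum_ext; apply: (periodic_forall (e := 8)) => //; exact: sym_shift.
Qed.

Let Y := line_sum odd8.

Let Y_double : Y + Y = line_sum (fun j => odd8 j + odd8 (3 * j + 4)%N).
Proof. by rewrite {2}/Y (line_sum_conj periodic_odd8) -line_sumD. Qed.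

Lemma line_sum1 : T 1 = 2 * Y.
Proof.
apply: int_double; have -> : 2 * Y + 2 * Y = (Y + Y) + (Y + Y) by ring.
rewrite T_double Y_double -line_sumD; apply: line_sum_ext.
apply: (periodic_forall (e := 8)) => // j.
by have h := sym_periodic periodic_odd8 j; exact: (congr1 (fun u => u + u) h).
Qed.

Let sg2 (c : F) : c \in L -> c != 0 -> g c ^+ 2 = 1.
Proof.
move=> cL c0; rewrite /g /index_fun (negPf c0) sgn8_sqr.
by have /dvdnP[k ->] := fixed_dlog4 c0 cL; rewrite oddM andbF.
Qed.

Let g0 : g 0 = 0. Proof. by rewrite /g /index_fun eqxx. Qed.

Let sum_sg : \sum_(c in L) g c = 0.
Proof.
have [_ LB _] := divring_closed_fixed pp lE cF.
have LN c : (- c \in L) = (c \in L).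
  by apply/idP/idP => h; [rewrite -[c]opprK -[- - c]sub0r LB|rewrite -sub0r LB];
    rewrite ?(fixed0 cF).
suff e : \sum_(c in L) g c = - \sum_(c in L) g c.
  by move: e; move: (\sum_(c in _) _) => S; clear; lia.
rewrite {1}(reindex_inj oppr_inj) /= (eq_bigl _ _ LN) -sumrN.
by apply: eq_bigr => c _; apply: sgn8_opp.
Qed.

Let sum_g2 : \sum_z g z ^+ 2 = (2 * n)%:R *+ (l - 1).
Proof.
have pw : periodic 8 (fun k => sgn8 k ^+ 2) by move=> k; rewrite periodic_sgn8.
rewrite (eq_bigr (index_fun A (fun k => sgn8 k ^+ 2))); last first.
  by move=> x _; rewrite /g /index_fun; case: eqP; rewrite ?expr0n.
rewrite (sum_index_fun hA en pw).
have -> : \sum_(i < 8) sgn8 i ^+ 2 = 4 by rewrite !big_ord_recl big_ord0.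
rewrite cF1 mulKn // -[4 in LHS]/(4%:R) -!mulrnA; congr (_ *+ _).
by move: ln; clear; nia.
Qed.

(** Apply [acorr_plane] with [sg] equal to [g], whose sum over [L] is 0. Once [S2] is read off the
    total of squares, the two occurrences of [g d ^+ 2] cancel. *)
Lemma acorr_sgn8 (d : F) : d != 0 -> acorr g d = T (dlog A d) ^+ 2 - (2 * n)%:R.
Proof.
move=> d0; have hz : y * d / d \notin L by rewrite mulfK // y_notin_fixed.
have l1 : (0 < l - 1)%N by move: ln n0; clear; lia.
have e2 := sum_sqr_plane hA pp lE cF d0 hz g0 sg2 sgn8_homog.
have e3 := acorr_plane hA pp lE cF d0 hz g0 sg2
  (fun c z cL _ => sgn8_homog z cL) sgn8_homog.
have TE : \sum_(c in L) g (y * d + c * d) = T (dlog A d).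
  apply: eq_bigr => c cL; have yc := y_add_neq0 cL.
  by rewrite -mulrDl /g (index_funE en periodic_sgn8 _ (dlogM hA en yc d0)) ?mulf_neq0.
move: e2 e3; rewrite sum_g2 sum_sg TE.
move: (\sum_(c in L) _ ^+ 2) => S2 e2 ->.
have -> : S2 = (2 * n)%:R - g d ^+ 2.
  move: e2; rewrite -[LHS]mulr_natr -[RHS]mulr_natr => /mulIf ->; first by ring.
  by rewrite pnatr_eq0 -lt0n.
by ring.
Qed.

Let lZ : l%:Z = 4 * n%:Z - 1. Proof. by move: ln; clear; lia. Qed.

(** The autocorrelations sum to the square of the total of [g], which is 0, and [d = 0] contributes
    the number of nonzero values. Over one period the squares of [T] run twice through [T 0 ^+ 2],
    [4 * Y ^+ 2], [T 0 ^+ 2], 0. *)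
Lemma norm_order8 : T 0 ^+ 2 + 2 * Y ^+ 2 = l%:Z.
Proof.
have tot : \sum_d acorr g d = 0.
  rewrite sum_acorr (sum_index_fun hA en periodic_sgn8).
  have -> : \sum_(i < 8) sgn8 i = 0 by rewrite !big_ord_recl big_ord0.
  by rewrite mul0rn mul0r.
have pT : periodic 8 (fun k => T k ^+ 2) by move=> k; rewrite line_sum_periodic.
have S8 : \sum_(i < 8) T i ^+ 2 = 4 * (T 0 ^+ 2 + 2 * Y ^+ 2).
  rewrite !big_ord_recl big_ord0 /=.
  rewrite /bump /= !add1n (line_sum_shift4 0) (line_sum_shift4 1) (line_sum_shift4 2).
  by rewrite (line_sum_shift4 3) line_sum3 line_sum2 line_sum1; ring.
have : \sum_(d | d != 0) (T (dlog A d) ^+ 2 - (2 * n)%:R) = - ((2 * n)%:R *+ (l - 1)).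
  rewrite -sum_g2 -[LHS](eq_bigr _ (fun d d0 => acorr_sgn8 d0)).
  apply/eqP; rewrite -addr_eq0 addrC -[X in _ == X]tot [X in _ == X](bigD1 0) //=.
  by rewrite acorr0.
rewrite sumrB (sum_dlog_periodic hA en pT) S8 (sum_dlog hA) sumr_const card_ord.
rewrite cF1 mulKn //; move: (T 0 ^+ 2 + _) => U.
set M := (n * (2 * n - 1))%N.
have hM : ((2 * n)%:R *+ (l - 1) : int) = 4 * M%:Z.
  by rewrite -mulrnA natz /M; move: ln; clear; nia.
have M0 : M%:Z != 0 by rewrite /M; move: n0; clear; nia.
rewrite hM -mulrnA -[4 * U *+ M]mulr_natr !natz => h.
apply: (mulIf M0); rewrite lZ; move: h; rewrite !PoszM; move: (Posz M) => M'; clear; lia.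
Qed.

Let M := (n * (2 * n - 1))%N.
(** A primitive eighth root of unity in [F]; on nonzero elements its character is [x |-> x ^+ M]. *)
Let z := A ^+ M.

Let z4 : z ^+ 4 = -1.
Proof.
rewrite /z -exprM -(expr_half_card hA oF) cF1 -/M; congr (_ ^+ _).
by move: M; clear; lia.
Qed.

Let z8 : z ^+ 8 = 1.
Proof. by rewrite -[8%N]/(4 * 2)%N exprM z4 sqrrN expr1n. Qed.

Let zE (k : nat) : z ^+ (k + 4) = - z ^+ k.
Proof. by rewrite exprD z4 mulrN1. Qed.

(** Symmetrised under conjugation, the seventh power of this character is a combination of the
    tables behind [T 0] and [Y], so its sum over the line vanishes when [p] divides both. *)
Lemma order8_expansion (j : nat) :
  z ^+ (7 * j) + z ^+ (7 * (3 * j + 4)) =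
  - z ^+ 2 * (sgn8 j + sgn8 (3 * j + 4))%:~R
  + (z - z ^+ 3) * (odd8 j + odd8 (3 * j + 4))%:~R.
Proof.
have pz := periodic_expr z8.
have P7 : periodic 8 (fun j => z ^+ (7 * j)).
  by move=> k; apply: (periodic_eq pz); rewrite modnMmr.
rewrite -(sym_periodic periodic_sgn8) -(sym_periodic periodic_odd8) -[z ^+ (7 * j)]P7.
rewrite -[z ^+ (7 * (3 * j + 4))](periodic_comp 3 4 P7).
have : (j %% 8 < 8)%N by rewrite ltn_mod.
have E k v : k = v %[mod 8] -> z ^+ k = z ^+ v by move=> h; apply: (periodic_eq pz).
case: (j %% 8)%N => [|[|[|[|[|[|[|[|//]]]]]]]] _.
- rewrite (E (7 * 0)%N 0%N) // (E (7 * (3 * 0 + 4))%N (0 + 4)%N) // zE.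
  rewrite -[sgn8 _ + _]/(0 : int) -[odd8 _ + _]/(0 : int) expr0; ring.
- rewrite (E (7 * 1)%N (3 + 4)%N) // (E (7 * (3 * 1 + 4))%N 1%N) // zE.
  rewrite -[sgn8 _ + _]/(0 : int) -[odd8 _ + _]/(1 : int); ring.
- rewrite (E (7 * 2)%N (2 + 4)%N) // (E (7 * (3 * 2 + 4))%N (2 + 4)%N) // zE.
  rewrite -[sgn8 _ + _]/(2 : int) -[odd8 _ + _]/(0 : int); ring.
- rewrite (E (7 * 3)%N (1 + 4)%N) // (E (7 * (3 * 3 + 4))%N 3%N) // zE.
  rewrite -[sgn8 _ + _]/(0 : int) -[odd8 _ + _]/(-1 : int); ring.
- rewrite (E (7 * 4)%N (0 + 4)%N) // (E (7 * (3 * 4 + 4))%N 0%N) // zE.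
  rewrite -[sgn8 _ + _]/(0 : int) -[odd8 _ + _]/(0 : int) expr0; ring.
- rewrite (E (7 * 5)%N 3%N) // (E (7 * (3 * 5 + 4))%N (1 + 4)%N) // zE.
  rewrite -[sgn8 _ + _]/(0 : int) -[odd8 _ + _]/(-1 : int); ring.
- rewrite (E (7 * 6)%N 2%N) // (E (7 * (3 * 6 + 4))%N 2%N) //.
  rewrite -[sgn8 _ + _]/(-2 : int) -[odd8 _ + _]/(0 : int); ring.
rewrite (E (7 * 7)%N 1%N) // (E (7 * (3 * 7 + 4))%N (3 + 4)%N) // zE.
rewrite -[sgn8 _ + _]/(0 : int) -[odd8 _ + _]/(1 : int); ring.
Qed.

Lemma line_power_sum_eq0 : (T 0)%:~R = 0 :> F -> Y%:~R = 0 :> F ->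
  \sum_(c in L) (y + c) ^+ (7 * M) = 0.
Proof.
move=> X0 Y0; set P := LHS.
have P7 : periodic 8 (fun j => z ^+ (7 * j)).
  by move=> k; apply: (periodic_eq (periodic_expr z8)); rewrite modnMmr.
have PE : P = line_sum (fun j => z ^+ (7 * j)).
  apply: eq_bigr => c cL; rewrite -{1}(dlogK hA (y_add_neq0 cL)) /z -!exprM.
  by congr (_ ^+ _); ring.
have PP : P + P = 0.
  rewrite {2}PE (line_sum_conj P7) PE -line_sumD (line_sum_ext order8_expansion).
  rewrite line_sumD /line_sum -!mulr_sumr -!rmorph_sum /= -!/(line_sum _).
  have -> : \sum_(c in L) (sgn8 (dlog A (y + c)) + sgn8 (3 * dlog A (y + c) + 4)) = T 0 + T 0.
    by rewrite T_double; apply: eq_bigr => c _; rewrite !addn0.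
  have -> : \sum_(c in L) (odd8 (dlog A (y + c)) + odd8 (3 * dlog A (y + c) + 4)) = Y + Y.
    by rewrite Y_double.
  by rewrite !rmorphD /= X0 Y0; ring.
move: PP; rewrite -mulr2n -mulr_natl => /eqP; rewrite mulf_eq0 (negPf two_neq0) => /eqP //.
Qed.

(* On the line e * (y + L) the factor z^l - z is constant. *)
Lemma plane_power_sum_eq0 : \sum_(c in L) (y + c) ^+ (7 * M) = 0 ->
  \sum_(x : F) (x ^+ l - x) ^+ (2 * n - 1) * x ^+ (7 * M) = 0.
Proof.
move=> P0; have hz : y / 1 \notin L by rewrite divr1 y_notin_fixed.
rewrite (sum_plane_decomp hA pp lE cF (oner_neq0 _) hz); apply: big1 => e eL.
have m0 : (0 < 2 * n - 1)%N by move: n0; clear; lia.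
have [->|e0] := eqVneq e 0.
  apply: big1 => c cL; rewrite mul0r add0r mulr1 (eqP cL) subrr expr0n.
  by rewrite (gtn_eqF m0) mul0r.
rewrite (sum_line_scale pp lE cF _ _ (fun x => (x ^+ l - x) ^+ (2 * n - 1) * x ^+ (7 * M)) eL e0).
rewrite (eq_bigr (fun c => ((- (2 * e * y)) ^+ (2 * n - 1) * e ^+ (7 * M)) * (y + c) ^+ (7 * M))).
  by rewrite -mulr_sumr P0 mulr0.
move=> c cL; rewrite mulr1.
have -> : (e * (y + c)) ^+ l - e * (y + c) = - (2 * e * y).
  by rewrite exprMn (frob_add pp lE cF) frob_y (eqP cL) (eqP eL); ring.
by rewrite exprMn mulrA.
Qed.

(* After expanding (x^l - x)^(2 n - 1), i0 is the only index whose exponent is a multiple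
   of q - 1, so the sum is +- 'C(2 n - 1, i0). *)
Lemma plane_power_sum_neq0 :
  \sum_(x : F) (x ^+ l - x) ^+ (2 * n - 1) * x ^+ (7 * M) != 0.
Proof.
have pF : p \in [pchar F] by apply: (card_finPcharP (n := r * 2)); rewrite // cF lE expnM.
set m := (2 * n - 1)%N; pose i0 := ((3 * n - 1) %/ 2)%N.
have i0m : (i0 < m.+1)%N by rewrite /i0 /m; move: n0; clear; lia.
have i0E : (i0 * 2 = 3 * n - 1)%N by rewrite /i0; move: on; clear; lia.
have M0 : (0 < M)%N by rewrite /M muln_gt0 n0 /=; move: n0; clear; lia.
have -> : \sum_(x : F) (x ^+ l - x) ^+ m * x ^+ (7 * M) =
    \sum_(i < m.+1) ((-1) ^+ i *+ 'C(m, i)) * \sum_(x : F) x ^+ (l * (m - i) + i + 7 * M).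
  under [RHS]eq_bigr do rewrite mulr_sumr.
  rewrite exchange_big; apply: eq_bigr => x _ /=; rewrite exprBn mulr_suml.
  apply: eq_bigr => i _; rewrite !exprD exprM !mulrnAl; congr (_ *+ _); ring.
(* The exponent is [m * (11 * n - 1 - 2 * i)] and [#|F|.-1 = 8 * n * m]. For [i <= m] the cofactor
   lies between [7 * n + 1] and [11 * n - 1], so it has to be [8 * n]. *)
have dv (i : nat) : (i <= m)%N -> (#|F|.-1 %| l * (m - i) + i + 7 * M)%N = (i == i0).
  move=> im; have -> : (l * (m - i) + i + 7 * M = m * (11 * n - 1 - 2 * i))%N.
    move: ln im n0; rewrite /M /m; clear => h im n0.
    have -> : l = (4 * n - 1)%N by lia.
    by nia.
  rewrite cF1 -/m [(n * m)%N]mulnC mulnCA dvdn_pmul2l; last by rewrite /m; move: n0; clear; lia.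
  move: im i0E n0; rewrite /m; clear => im i0E n0; apply/dvdnP/eqP => [[k hk]|->].
    by case: k hk => [|[|k]] hk; nia.
  by exists 1%N; lia.
rewrite (bigD1 (Ordinal i0m)) //= [X in _ + X]big1 ?addr0 => [|i /eqP ni]; last first.
  have im : (i <= m)%N by rewrite -ltnS.
  rewrite (sum_expr hA) ?dv //; last by rewrite addn_gt0 muln_gt0 M0 orbT.
  by case: eqP => [e|_]; [case: ni; apply: val_inj|rewrite mulr0].
rewrite (sum_expr hA) ?dv ?eqxx //; last by rewrite addn_gt0 muln_gt0 M0 orbT.
rewrite mulrN1 oppr_eq0 -mulr_natr mulf_neq0 ?signr_eq0 //.
rewrite -(dvdn_pcharf pF); have -> : m = (i0 + (n - 1) %/ 2)%N.
  by rewrite /m; move: i0E on n0; clear; lia.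
apply: prime_ndvd_bin => // k.
(* As [8 * i0 + 1 = 3 * l] and [8 * ((n - 1) %/ 2) + 3 = l], each [p ^ k] with [k <= r] satisfies
   the divisibilities of [no_carry_mod8]. *)
have [kr|rk] := leqP k r.
  have p3 : p = 3 %[mod 8] by apply: (@pow_mod8 p r); rewrite -lE; move: ln on; clear; lia.
  have pl : (p ^ k %| l)%N by rewrite lE dvdn_exp2l.
  apply: no_carry_mod8; first exact: pow3_mod8.
    have -> : (8 * i0 + 1 = 3 * l)%N by move: i0E ln n0; clear; lia.
    by rewrite dvdn_mull.
  by have -> : (8 * ((n - 1) %/ 2) + 3 = l)%N by move: on ln n0; clear; lia.
have lt : (l < p ^ k)%N by rewrite lE ltn_exp2l // prime_gt1.
have le : (i0 + (n - 1) %/ 2 < l)%N by move: i0E on ln n0; clear; lia.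
by rewrite !modn_small; lia.
Qed.

(** If [p] divided [T 0] then, being odd, it would divide [Y] by the norm equation. Both would
    vanish in [F], and with them the power sums over the line and over the plane, but the latter is
    a nonzero binomial coefficient up to sign. *)
Lemma prime_ndvd_line_sum : ~~ (p %| T 0)%Z.
Proof.
have pF : p \in [pchar F] by apply: (card_finPcharP (n := r * 2)); rewrite // cF lE expnM.
have r0 : (0 < r)%N by case: r lE => // h; move: ln n0; rewrite h; clear; lia.
have p2 : (p %| 2)%N = false.
  apply/negP => /(dvdn_leq (isT : 0 < 2)%N) le2.
  have : p = 3 %[mod 8] by apply: (@pow_mod8 p r); rewrite -lE; move: ln on; clear; lia.
  by move: le2; clear; lia.
apply/negP => pX; have pY : (p %| Y)%Z.
  have : (p %| 2 * Y ^+ 2)%Z.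
    have -> : 2 * Y ^+ 2 = l%:Z - T 0 ^+ 2 by rewrite -norm_order8; ring.
    by rewrite rpredB ?dvdz_exp // lE dvdzE /= dvdn_exp.
  by rewrite !dvdzE abszM abszX Euclid_dvdM // p2 /= Euclid_dvdX // => /andP[].
have toF (c : int) : (p %| c)%Z -> c%:~R = 0 :> F.
  by move/dvdzP=> [d ->]; rewrite intrM [p%:~R](pcharf0 pF) mulr0.
have := plane_power_sum_neq0; rewrite plane_power_sum_eq0 ?eqxx //.
by apply: line_power_sum_eq0; apply: toF.
Qed.

End Order8.

(** * Case (2): combining the even and odd parts *)

Section Order8Delta.
Import Order.TTheory GRing.Theory Num.Theory.
Local Open Scope ring_scope.
Variables (F : finFieldType) (A : F).
Hypothesis hA : (#|F|.-1).-primitive_root A.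
Variables (p r l n t : nat).
Hypotheses (pp : prime p) (lE : l = (p ^ r)%N) (cF : #|F| = (l ^ 2)%N).
Hypotheses (ln : (l + 1 = 4 * n)%N) (on : odd n) (lt2 : l = (t ^ 2 + 2)%N).

Let n0 : (0 < n)%N. Proof. exact: odd_gt0. Qed.
Let cF1 : #|F|.-1 = (8 * (n * (2 * n - 1)))%N.
Proof. rewrite (card_F_pred cF); move: n0 ln; clear; nia. Qed.
Let en : (8 %| #|F|.-1)%N. Proof. by rewrite cF1 dvdn_mulr. Qed.
Let ol : odd l. Proof. by move: ln; clear; lia. Qed.

Let g1 := index_fun A sin4.
Let g2 := index_fun A sgn8.

Let periodic8_sin4 : periodic 8 sin4.
Proof. by move=> k; apply: (periodic_eq periodic_sin4); rewrite modn_dvdm. Qed.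

Lemma acorr_sin4 (d : F) : d != 0 ->
  acorr g1 d = l%:Z * (odd (dlog A d))%:R - (2 * n)%:R.
Proof.
move=> d0; have pw : periodic (l + 1) sin4.
  by move=> k; apply: (periodic_eq periodic_sin4); rewrite ln modn_dvdm ?dvdn_mulr.
have pw2 : periodic 4 (fun k => sin4 k ^+ 2) by move=> k; rewrite periodic_sin4.
have sqr k : sin4 k ^+ 2 = (odd k)%:R.
  move: k; apply: (periodic_forall (e := 4)) => // k; by rewrite odd_mod.
rewrite (acorr_lines hA pp lE cF ol pw _ d0) ?sqr; last first.
  by rewrite ln mulnC (sum_periodic _ periodic_sin4) !big_ord_recl big_ord0 mul0rn.
rewrite ln mulnC (sum_periodic _ pw2).
have -> : \sum_(i < 4) sin4 i ^+ 2 = 2 by rewrite !big_ord_recl big_ord0.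
by rewrite -[2 in LHS]/(2%:R) -mulrnA.
Qed.

(* x |-> - x - d exchanges the two products up to sign, as g1 is even and g2 is odd. *)
Lemma acorr_sin4_sgn8 (d : F) :
  \sum_x (g1 x * g2 (x + d) + g2 x * g1 (x + d)) = 0.
Proof.
have g1N x : g1 (- x) = g1 x.
  have [->|x0] := eqVneq x 0; first by rewrite oppr0.
  rewrite /g1 (index_funE en periodic8_sin4 _ (dlogN8 hA cF ln on x0)) ?oppr_eq0 //.
  rewrite /index_fun (negPf x0); apply: (periodic_eq periodic_sin4).
  by rewrite modnDr.
rewrite big_split /= [X in _ + X](reindex_inj (subrI (- d))) /= -big_split /=.
apply: big1 => x _; have -> : - d - x + d = - x by ring.
have -> : - d - x = - (x + d) by ring.
by rewrite g1N /g2 (sgn8_opp hA cF ln on) mulNr mulrC subrr.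
Qed.

Lemma delta_order8 (d : F) : d != 0 ->
  let C := index_set A (fun k => (k %% 8)%N \in [:: 0; 1; 2; 5]%N) in
  (4 * delta C d + 5 = #|F| \/ 4 * delta C d + 1 = #|F|)%N.
Proof.
move=> d0 C.
have pc : periodic 8 (fun k => (k %% 8)%N \in [:: 0; 1; 2; 5]%N).
  by move=> k; rewrite modn_mod.
pose T k := line_sum A l n (fun j => sgn8 (j + k)%N); pose Y := line_sum A l n odd8.
have nX : T 0%N ^+ 2 + 2 * Y ^+ 2 = l%:Z := norm_order8 hA pp lE cF ln on.
have npX : ~~ (p %| T 0%N)%Z := prime_ndvd_line_sum hA pp lE cF ln on.
have ac2 : acorr g2 d = T (dlog A d) ^+ 2 - (2 * n)%:R := acorr_sgn8 hA pp lE cF ln on d0.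
have T1 : T 1%N = 2 * Y := line_sum1 hA pp lE cF ln on.
have T2 : T 2%N = - T 0%N := line_sum2 hA pp lE cF ln on.
have T3 : T 3%N = 0 := line_sum3 hA pp lE cF ln on.
have Tp k : T (k %% 8)%N = T k := line_sum_periodic A l n k.
have T4 k : T (k + 4)%N = - T k := line_sum_shift4 A l n k.
clearbody T Y.
have p2 : (p %| 2)%N = false.
  apply/negP => /(dvdn_leq (isT : 0 < 2)%N) le2.
  have : p = 3 %[mod 8] by apply: (@pow_mod8 p r); rewrite -lE; move: ln on; clear; lia.
  by move: le2; clear; lia.
(* The second representation of [l] is [t ^ 2 + 2 * 1 ^ 2]; the exceptional alternative requires
   [k = 1], whereas here [k = 2]. *)
have Y1 : Y ^+ 2 = 1.
  have : Y ^+ 2 = 1 ^+ 2 \/ ((2 = 1 :> int) /\ T 0%N ^+ 2 = 1 ^+ 2).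
    apply: (@norm_form_unique p r 2 (T 0%N) Y t%:Z 1 pp isT).
    - by rewrite nX lE.
    - by rewrite -lE lt2 PoszD expr1n mulr1 -!mulnn PoszM.
    by rewrite mulr1 dvdzE abszM Euclid_dvdM // p2 -dvdzE.
  by case=> [->|[]//]; rewrite expr1n.
have balE x : balance C x = g1 x + g2 x.
  rewrite balance_index_set /g1 /g2 /index_fun; case: eqP => // _.
  move: (dlog A x); apply: (periodic_forall (e := 8)) => // k.
    by rewrite modn_mod.
  by rewrite periodic8_sin4 periodic_sgn8.
have acE : acorr (balance C) d = acorr g1 d + acorr g2 d.
  rewrite -[RHS]addr0 -(acorr_sin4_sgn8 d) /acorr -!big_split /=; apply: eq_bigr => x _.
  by rewrite !balE; ring.
have cC : ((2 * #|C|).+1 = #|F|)%N.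
  rewrite (card_index_set hA en pc) !big_ord_recl big_ord0 /=.
  rewrite -[in RHS](prednK (n := #|F|)); last by apply/card_gt0P; exists 0.
  by rewrite cF1 mulKn // mulnA.
have := delta_balance (index_set0 A _) cC d0; rewrite acE (acorr_sin4 d0) ac2 -Tp.
rewrite !inE oppr_eq0 d0 /= (dlogN8 hA cF ln on d0) -[((dlog A d + 4) %% 8)%N]modnDml.
rewrite -[odd (dlog A d)](odd_mod _ (erefl : odd 8 = false)).
have X2 : T 0%N ^+ 2 = l%:Z - 2 by rewrite -nX Y1; ring.
have T12 : T 1%N ^+ 2 = 4 by rewrite T1 exprMn Y1.
have T22 : T 2%N ^+ 2 = l%:Z - 2 by rewrite T2 sqrrN.
have T32 : T 3%N ^+ 2 = 0 by rewrite T3 expr0n.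
have Tsq k : T (k + 4)%N ^+ 2 = T k ^+ 2 by rewrite T4 sqrrN.
rewrite -/C !natz; move: (delta C d) #|F| => D Q.
have : (dlog A d %% 8 < 8)%N by rewrite ltn_mod.
(* The autocorrelation is -3 at even indices, where exactly one of [d] and [- d] lies in [C]. It is
   3 at indices 1 and 5, where both do, and -1 at 3 and 7, where neither does. *)
case: (dlog A d %% 8)%N => [|[|[|[|[|[|[|[|//]]]]]]]] _.
- rewrite X2 /=; move: ln; clear; lia.
- rewrite T12 /=; move: ln; clear; lia.
- rewrite T22 /=; move: ln; clear; lia.
- rewrite T32 /=; move: ln; clear; lia.
- rewrite (Tsq 0%N) X2 /=; move: ln; clear; lia.
- rewrite (Tsq 1%N) T12 /=; move: ln; clear; lia.
- rewrite (Tsq 2%N) T22 /=; move: ln; clear; lia.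
rewrite (Tsq 3%N) T32 /=; move: ln; clear; lia.
Qed.

End Order8Delta.

(** * The adesigns *)

Section Unions.
Import Order.TTheory GRing.Theory Num.Theory.
Local Open Scope ring_scope.
Variables (F : finFieldType) (a : {unit F}).
Hypotheses (ha : primitive_element a) (oF : odd #|F|).
Let hA := primitive_elementP ha.

Lemma card_half_index_set (c : nat -> bool) (e : nat) : (e %| #|F|.-1)%N -> periodic e c ->
  (2 * \sum_(i < e) c i = e)%N -> #|index_set (val a) c| = ((#|F| - 1) %/ 2)%N.
Proof.
move=> en pc c2; rewrite (card_index_set hA en pc) subn1 -[in RHS](divnK en).
by move: (\sum_(i < e) _)%N (_ %/ e)%N c2 => S m <-; rewrite mulnCA mulKn // mulnC.
Qed.

Lemma card_even_odd (i : nat) : #|cyclotomic_class a 2 i| = ((#|F| - 1) %/ 2)%N.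
Proof.
have en : (2 %| #|F|.-1)%N by rewrite dvdn2; move: oF; clear; lia.
rewrite (cyclotomic_classE ha _ en); apply: (card_half_index_set en).
  by move=> k; rewrite modn_mod.
by rewrite !big_ord_recl big_ord0 /= !modn2; case: (odd i).
Qed.

Lemma union_order4 (i : nat) : (4 %| #|F|.-1)%N ->
  cyclotomic_class a 4 i :|: cyclotomic_class a 4 i.+1 =
  [set val a ^+ i * x | x in index_set (val a) (fun k => (k %% 4 < 2)%N)].
Proof.
move=> en; have A0 := expf_neq0 i (prim_root_neq0 hA); rewrite !(cyclotomic_classE ha _ en).
apply/setP => x; rewrite -[x](mulVKf A0) (mem_imset _ _ (mulfI A0)); move: (_^-1 * x) => {}x.
rewrite !inE mulf_eq0 negb_or A0 /=; have [//|x0] := eqVneq x 0.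
rewrite (dlogM hA en A0 x0) -!(modnDml (dlog _ (_ ^+ i))) (dlog_pow hA i en) !modnDml.
move: (dlog _ x) => k; clear; lia.
Qed.

Lemma union_order8 : (8 %| #|F|.-1)%N ->
  cyclotomic_class a 8 0 :|: cyclotomic_class a 8 1 :|: cyclotomic_class a 8 2
    :|: cyclotomic_class a 8 5 =
  index_set (val a) (fun k => (k %% 8)%N \in [:: 0; 1; 2; 5]%N).
Proof.
move=> en; rewrite !(cyclotomic_classE ha _ en); apply/setP => x; rewrite !inE.
by case: (x != 0) => //=; rewrite -!orbA.
Qed.

Lemma union_lines (l : nat) (I : {set 'I_l.+1}) : (l.+1 %| #|F|.-1)%N ->
  \bigcup_(i in I) cyclotomic_class a l.+1 i =
  index_set (val a) (fun k => inord (k %% l.+1) \in I).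
Proof.
move=> en; apply/setP => x; rewrite inE; apply/bigcupP/andP => [[i iI]|[x0 xI]].
  rewrite (cyclotomic_classE ha _ en) inE => /andP[x0 /eqP xi]; split=> //.
  by rewrite xi modn_small // inord_val.
exists (inord (dlog (val a) x %% l.+1)) => //.
by rewrite (cyclotomic_classE ha _ en) inE x0 inordK ?ltn_mod //= modn_mod.
Qed.

End Unions.

Theorem theorem8 (F : finFieldType) (q : nat) (a : {unit F}) (C : {set F})
  (hF : #|F| = q) (hq : prime_power q) (hodd : odd q)
  (ha : primitive_element a)
  (hC :
    (exists i : nat, exists s : int,
       [/\ C = cyclotomic_class a 4 i :|: cyclotomic_class a 4 i.+1,
           q = 5 %[mod 8],
           (q%:Z = s ^+ 2 + 4)%R
         & (s = 1 %[mod 4])%Z])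
    \/
    (exists l t : nat,
       [/\ C = cyclotomic_class a 8 0 :|: cyclotomic_class a 8 1
                 :|: cyclotomic_class a 8 2 :|: cyclotomic_class a 8 5,
           q = l ^ 2,
           prime_power l,
           l = t ^ 2 + 2
         & l = 3 %[mod 8]])
    \/
    (exists l : nat, exists I : {set 'I_l.+1},
       [/\ q = l ^ 2 /\ prime_power l,
           C = \bigcup_(i in I) cyclotomic_class a l.+1 i,
           #|I| = l.+1 %/ 2,
           exists2 i : 'I_l.+1, i \in I & ~~ odd i
         & exists2 i : 'I_l.+1, i \in I & odd i])) :
  is_adesign 2 q ((q - 1) %/ 2) ((3 * q - 11) %/ 4)
    (Dev (cyclotomic_class a 2 0) ++ Dev (cyclotomic_class a 2 1) ++ Dev C).

move: hF hq hodd hC => <- {}hq oF hC'; have hA := primitive_elementP ha.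
have e2 : 2 %| #|F|.-1 by rewrite dvdn2; move: oF; clear; lia.
suff [cC dC] : #|C| = (#|F| - 1) %/ 2 /\
    forall d, d != 0%R -> 4 * delta C d + 5 = #|F| \/ 4 * delta C d + 1 = #|F|.
  apply: adesign_of_delta; rewrite ?card_even_odd // => d d0.
  by rewrite !(cyclotomic_classE ha _ e2) (delta_squares hA).
case: hC' => [[i [s [-> q5 qs _]]]|
  [[l [t [-> ql [p [r [pp _ lE]]] lt l3]]]|[l [I [[ql [p [r [pp _ lE]]]] -> cI _ _]]]]].
- have [p [r [pp _ cF]]] := hq.
  have nf : #|F|.-1 = 4 * (#|F|.-1 %/ 4) by move: q5; clear; lia.
  have fo : odd (#|F|.-1 %/ 4) by move: q5; clear; lia.
  have en : 4 %| #|F|.-1 by rewrite nf dvdn_mulr.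
  have A0 := GRing.expf_neq0 i (prim_root_neq0 hA).
  rewrite (union_order4 ha i en); split.
    rewrite card_imset; last exact: GRing.mulfI.
    apply: (card_half_index_set ha en); first by move=> k; rewrite modn_mod.
    by rewrite !big_ord_recl big_ord0.
  move=> d d0; rewrite -[d](GRing.mulVKf A0) (delta_scale _ _ A0).
  by apply: (delta_order4 hA pp cF nf fo qs); rewrite GRing.mulf_neq0 ?GRing.invr_eq0.
- have ln : l + 1 = 4 * ((l + 1) %/ 4) by move: l3; clear; lia.
  have on : odd ((l + 1) %/ 4) by move: l3; clear; lia.
  have en : 8 %| #|F|.-1.
    rewrite (card_F_pred ql); move: ln on l3; move: (_ %/ 4) => n; clear => ln on l3.
    by rewrite ln -[8]/(4 * 2) -mulnA dvdn_pmul2l // dvdn_mull // dvdn2; lia.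
  rewrite (union_order8 ha en); split; last first.
    by move=> d; apply: (delta_order8 hA pp lE ql ln on lt).
  apply: (card_half_index_set ha en); first by move=> k; rewrite modn_mod.
  by rewrite !big_ord_recl big_ord0.
have ol : odd l by move: oF; rewrite ql oddX.
have en : l.+1 %| #|F|.-1 by rewrite -addn1 dvdn_succ_card.
pose c k := inord (k %% l.+1) \in I.
have pc : periodic l.+1 c by move=> k; rewrite /c modn_mod.
have sc : \sum_(k < l.+1) c k = l.+1 %/ 2.
  rewrite -cI -sum1_card [RHS]big_mkcond; apply: eq_bigr => k _.
  by rewrite /c modn_small // inord_val; case: (_ \in _).
rewrite (union_lines ha I en); split.
  by apply: (card_half_index_set ha en pc); rewrite sc; move: ol; clear; lia.
by move=> d; apply: (delta_lines hA pp lE ql ol); rewrite addn1.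
Qed.
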